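(* Let $i\in\{1,\ldots,N\}$ and let $v$ be a supersolution of the stationary problem $\Delta_\Omega v+f(v)=0$ on $\Omega$ such that $0\le v\le1$ and $$\lim_{x_i\to\infty}v|_{\Omega_i}(x_i)=1.$$ Then $v\ge\widehat v_i$ on $\Omega$, where $\widehat v_i$ is the limit profile associated with $\Omega_i$. In particular, $\widehat v_i$ is minimal among all the solutions $v$ of $\Delta_\Omega v+f(v)=0$ on $\Omega$ with $0\le v\le 1$ satisfying $\lim_{x_i\to\infty}v|_{\Omega_i}(x_i)=1$.
   Context: Metric graphs: a metric graph is a connected graph each of whose edges $E$ is identified with an interval $[0,L_E]$ (finite length $L_E>0$) or $[0,\infty)$ (infinite length); directions of edges only serve to fix coordinates. Multiple edges, loops and vertices of degree $1$ are allowed. Each edge $E$ has a constant thickness $\rho_E>0$. At a vertex $V$ with incident edges $E_1,\ldots,E_m$ (a loop is counted twice), $\frac{\partial u}{\partial\nu_k}(V)$ denotes the derivative of $u$ at $V$ along $E_k$ in the direction pointing from $V$ into the interior of $E_k$; the Kirchhoff condition at $V$ is $\sum_{k=1}^m\rho_{E_k}\frac{\partial u}{\partial\nu_k}(V)=0$. The graph $\Omega$: $\Omega=D\cup\Omega_1\cup\cdots\cup\Omega_N$ with $N\ge2$, where $D$ (the center graph) is a bounded finite metric graph (finitely many edges of finite length; possibly a single vertex) and each outer path $\Omega_i$ is an edge of infinite length with $D\cap\Omega_i=\{\mathrm P_i\}$, $\mathrm P_i$ being a vertex of $D$ (the $\mathrm P_i$ are not necessarily distinct). The coordinate on $\Omega_i$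 is $x_i\in[0,\infty)$, with $x_i=0$ at $\mathrm P_i$. Nonlinearity: $f\in C^1$ and for some $0<a<1$: $f(0)=f(a)=f(1)=0$, $f<0$ on $(0,a)$, $f>0$ on $(a,1)$, $f'(0)<0$, $f'(a)>0$, $f'(1)<0$, $\int_0^1f(s)\,ds>0$. Solution of $\partial_tu=\Delta_\Omega u+f(u)$ on a time interval: a function $u(t,x)$ continuous in $(t,x)$ that satisfies $\partial_tu=\partial_x^2u+f(u)$ on each edge except at endpoints, with $\partial_xu$ continuous on each edge up to the endpoints, and the Kirchhoff condition at every vertex. A solution of $\Delta_\Omega v+f(v)=0$ is a time-independent such solution. Supersolution of the stationary problem: a function $v$ continuous and piecewise $C^1$ on $\Omega$ with $\partial_x^2v+f(v)\le0$ on each edge (in the classical or the weak sense) and $\sum_{k}\rho_{E_k}\frac{\partial v}{\partial\nu_k}(V)\le0$ at every vertex $V$ (super-Kirchhoff condition). Traveling wave: $(\phi,c)$, $c>0$, is the unique pair with $\phi''+c\phi'+f(\phi)=0$ and $0<\phi<1$ on $\mathbb R$, $\phi(-\infty)=1$, $\phi(+\infty)=0$, $\phi(0)=a$. Front-like solution and limit profile: for each $i$ there is a unique entire solution $\widehat u_i$ (defined for all $t\in\mathbb R$) with $0<\widehat u_i<1$ and $\lim_{t\to-\infty}\big(\sup_{x_i\in\Omega_i}|\widehat u_i|_{\Omega_i}(t,x_i)-\phi(-x_i-ct)|+\sup_{\Omega\setminus\Omega_i}|\widehat u_i(t,\cdot)|\big)=0$; it is strictly increasing in $t$. The limit profile is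 $\widehat v_i(x)=\lim_{t\to\infty}\widehat u_i(t,x)$; it is a solution of $\Delta_\Omega\widehat v_i+f(\widehat v_i)=0$ on $\Omega$. *)

(* Defs.v *)
From mathcomp Require Import all_boot all_order all_algebra.
From mathcomp Require Import all_classical all_reals all_analysis.
Set Implicit Arguments.
Unset Strict Implicit.
Unset Printing Implicit Defensive.
Import Order.TTheory GRing.Theory Num.Theory.
Import numFieldNormedType.Exports.
Local Open Scope classical_set_scope.
Local Open Scope ring_scope.

(* The center graph D is (vert, cedge); loops and multiple edges are allowed,
   and D may be a single vertex.  The outer paths are indexed by 'I_npaths. *)
Record star_graph (R : realType) := StarGraph {
  vert : finType;
  cedge : finType;
  csrc : cedge -> vert;
  ctgt : cedge -> vert;
  clen : cedge -> R;
  clen_gt0 : forall e, 0 < clen e;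
  center_connected : forall V W : vert,
    connect (fun x y => [exists e, ((csrc e == x) && (ctgt e == y)) ||
                                   ((csrc e == y) && (ctgt e == x))]) V W;
  npaths : nat;
  npaths_ge2 : (2 <= npaths)%N;
  base : 'I_npaths -> vert;
  thick : cedge + 'I_npaths -> R;
  thick_gt0 : forall e, 0 < thick e }.

Section Graph.
Variables (R : realType) (Om : star_graph R).

Definition edge : finType := (cedge Om + 'I_(npaths Om))%type.

Definition outer (i : 'I_(npaths Om)) : edge := inr i.

(* The vertex at coordinate 0. *)
Definition src (e : edge) : vert Om :=
  match e with inl e => csrc e | inr i => base i end.

Definition edge_dom (e : edge) : interval R :=
  match e with inl e => `[0, clen e] | inr _ => `[0, +oo[ end.

Definition edge_int (e : edge) : interval R :=
  match e with inl e => `]0, clen e[ | inr _ => `]0, +oo[ end.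

(* A function on Om is given by its expressions in the edge coordinates; the
   values of v e outside edge_dom e are irrelevant.  Since Om is connected and
   has at least one edge, every point of Om lies on some edge. *)
Definition gfun := edge -> R -> R.

Definition gforall (P : edge -> R -> Prop) : Prop :=
  forall e x, x \in edge_dom e -> P e x.

(* The edgewise expressions agree at the vertices. *)
Definition vertex_compatible (v : gfun) : Prop :=
  exists val : vert Om -> R,
    (forall e : edge, v e 0 = val (src e)) /\
    (forall e : cedge Om, v (inl e) (clen e) = val (ctgt e)).

(* One-sided derivative of g at x in the direction s (s = 1 or -1). *)
Definition dir_deriv (g : R -> R) (x s : R) : R :=
  lim ((g (x + s * h) - g x) / h @[h --> 0^'+]).

(* Sum over the edge ends at V of thickness times the derivative pointing into
   the edge; a loop at V contributes to both sums. *)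
Definition flux (v : gfun) (V : vert Om) : R :=
  \sum_(e : edge | src e == V) thick e * dir_deriv (v e) 0 1 +
  \sum_(e : cedge Om | ctgt e == V)
     thick (inl e) * dir_deriv (v (inl e)) (clen e) (-1).

(* C^1 on I up to those endpoints that belong to I. *)
Definition C1_on (I : interval R) (g : R -> R) : Prop :=
  exists dg : R -> R,
    {within [set` I], continuous dg} /\
    (forall x, x \in I ->
       (g y - g x) / (y - x)
         @[y --> within [set y | y \in I /\ y != x] (nbhs x)] --> dg x).

(* B is the set of break points; it is only required to be locally finite, as
   I may be unbounded. *)
Definition piecewise_C1 (I : interval R) (g : R -> R) : Prop :=
  exists B : set R,
    (forall M : R, finite_set (B `&` [set` `[- M, M]])) /\
    (forall a b, a < b -> a \in I -> b \in I ->
       (forall x, a < x < b -> ~ B x) -> C1_on `[a, b] g).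

Definition twice_derivable (g : R -> R) (x : R) : Prop :=
  derivable g x 1 /\ derivable (derive1 g) x 1.

Variable f : R -> R.

Record entire_solution (u : R -> gfun) : Prop := {
  sol_continuous : forall e : edge,
    {within [set p : R * R | p.2 \in edge_dom e],
      continuous (fun p : R * R => u p.1 e p.2)};
  sol_vertex : forall t, vertex_compatible (u t);
  sol_equation : forall (e : edge) t x, x \in edge_int e ->
    derivable (fun s => u s e x) t 1 /\
    twice_derivable (u t e) x /\
    derive1 (fun s => u s e x) t = derive1n 2 (u t e) x + f (u t e x);
  sol_C1 : forall (e : edge) t, C1_on (edge_dom e) (u t e);
  sol_kirchhoff : forall t V, flux (u t) V = 0 }.

Definition stationary_solution (v : gfun) : Prop :=
  entire_solution (fun _ => v).

Definition super_classical (e : edge) (g : R -> R) : Prop :=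
  forall x, x \in edge_int e ->
    twice_derivable g x /\ derive1n 2 g x + f (g x) <= 0.

(* Both derivatives are moved onto the test function psi. *)
Definition super_weak (e : edge) (g : R -> R) : Prop :=
  forall psi : R -> R,
    (forall x, twice_derivable psi x) ->
    continuous (derive1n 2 psi) ->
    (forall x, 0 <= psi x) ->
    (exists a b, [/\ a \in edge_int e, b \in edge_int e &
       forall x, x \notin `[a, b] -> psi x = 0]) ->
    \int[lebesgue_measure]_(x in [set` edge_dom e])
       (g x * derive1n 2 psi x + f (g x) * psi x) <= 0.

Record supersolution (v : gfun) : Prop := {
  super_continuous : forall e : edge,
    {within [set` edge_dom e], continuous (v e)};
  super_vertex : vertex_compatible v;
  super_piecewise : forall e : edge, piecewise_C1 (edge_dom e) (v e);
  super_equation : forall e : edge,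
    super_classical e (v e) \/ super_weak e (v e);
  super_kirchhoff : forall V, flux v V <= 0 }.

Definition between01 (v : gfun) : Prop := gforall (fun e x => 0 <= v e x <= 1).

Definition tends_to_1_on (i : 'I_(npaths Om)) (v : gfun) : Prop :=
  v (outer i) x @[x --> +oo] --> (1 : R).

(* The second supremum is taken over the closed edges other than the i-th outer
   path; they add at most the point P_i to Om minus this path, which by
   continuity does not change the supremum.  Both suprema are of nonempty sets
   bounded above when 0 < u < 1 and 0 < phi < 1. *)
Definition front_like (phi : R -> R) (c : R) (i : 'I_(npaths Om))
    (u : R -> gfun) : Prop :=
  [/\ entire_solution u,
      forall t, gforall (fun e x => 0 < u t e x < 1) &
      sup [set `|u t (outer i) x - phi (- x - c * t)|
            | x in [set` edge_dom (outer i)]] +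
      sup [set `|u t p.1 p.2|
            | p in [set p : edge * R | p.1 != outer i /\ p.2 \in edge_dom p.1]]
        @[t --> -oo] --> (0 : R)].

Definition limit_profile (u : R -> gfun) (v : gfun) : Prop :=
  gforall (fun e x => u t e x @[t --> +oo] --> v e x).

End Graph.

Record bistable (R : realType) (f : R -> R) (a : R) : Prop := {
  bi_derivable : forall x, derivable f x 1;
  bi_C1 : continuous (derive1 f);
  bi_a : 0 < a < 1;
  bi_f0 : f 0 = 0;
  bi_fa : f a = 0;
  bi_f1 : f 1 = 0;
  bi_neg : forall s, 0 < s < a -> f s < 0;
  bi_pos : forall s, a < s < 1 -> 0 < f s;
  bi_df0 : derive1 f 0 < 0;
  bi_dfa : 0 < derive1 f a;
  bi_df1 : derive1 f 1 < 0;
  bi_int : 0 < \int[lebesgue_measure]_(s in [set` `[0, 1]]) f s }.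

Record travelling_wave (R : realType) (f : R -> R) (a : R)
    (phi : R -> R) (c : R) : Prop := {
  tw_speed : 0 < c;
  tw_ode : forall z, twice_derivable phi z /\
    derive1n 2 phi z + c * derive1 phi z + f (phi z) = 0;
  tw_range : forall z, 0 < phi z < 1;
  tw_minus : phi z @[z --> -oo] --> (1 : R);
  tw_plus : phi z @[z --> +oo] --> (0 : R);
  tw_norm : phi 0 = a }.

(* Main.v *)
Require Import Defs.
From mathcomp Require Import all_boot all_order all_algebra.
From mathcomp Require Import all_classical all_reals all_analysis.
From mathcomp Require Import ring lra.
Set Implicit Arguments.
Unset Strict Implicit.
Unset Printing Implicit Defensive.
Import Order.TTheory GRing.Theory Num.Theory.
Import numFieldNormedType.Exports.
Local Open Scope classical_set_scope.
Local Open Scope ring_scope.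

(** Let [w] be the difference of [uhat] and a supersolution [v], and let [t] be
    very negative.  Far out on the path [i], [v] is close to 1; on the rest of the
    graph the front has not arrived and [uhat] is close to 0.  So wherever
    [uhat] exceeds [v] both values lie in a stable range of [f], where
    [f (uhat) - f (v) <= - beta * w].  The maximum principle then gives
    [w <= expR (- beta * (t - T))] for every earlier [T], and [T --> -oo] yields
    [uhat <= v] for all very negative times.  The maximum principle with the
    Lipschitz constant of [f] propagates this to all times, and the inequality
    passes to the limit ([ordered_of_early_stability],
    [front_like_le_supersolution]).

    The maximum principle ([graph_maximum_principle]) needs a barrier at
    infinity which also has strictly negative slopes at the vertices.  Inside an
    edge it uses only that parabolas touching [w] from above satisfy the
    parabolic inequality; for a weak supersolution this is obtained by testing
    with an approximate second difference ([super_weak_touch]).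

    The same comparison between [uhat] and its own shift by a long time [S]
    gives [uhat t <= uhat (t + S)], hence [uhat t <= vhat], and [vhat] tends to 1
    along the path [i] because [uhat t] is close to 1 there for very negative [t].

    That [vhat] solves the stationary problem is shown without parabolic
    regularity theory.  If the values at the ends of an interval converge and
    the heat operator of a bounded function is at least [- A], then a decaying
    barrier shows that the limit lies above its chord up to
    [A / 2 * (x - y0) * (y1 - x)] ([evolves_chord]).  Applied to [uhat] and
    [- uhat] this makes [vhat] Lipschitz on the edges and the convergence locally
    uniform ([evolves_uniform]).  Now add to [uhat] a second antiderivative in
    space of [f (vhat)]: the heat operator of the sum tends to 0 uniformly, so
    its limit is affine on each edge, which is the equation together with its
    regularity up to the vertices ([limit_profile_regular]).  The same barrier on
    a star of radius [r] about a vertex bounds the Kirchhoff sum of difference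
    quotients by a multiple of [r], whence the Kirchhoff condition
    ([limit_profile_kirchhoff]). *)

(** * One-variable calculus *)

Section OneVariable.
Variable R : realType.
Implicit Types (g k : R -> R) (x l : R).

Lemma is_derive_eps g x l (eps : R) : is_derive x 1 g l -> 0 < eps ->
  exists2 d : R, 0 < d & forall h, h != 0 -> `|h| < d ->
    `|(g (x + h) - g x) / h - l| < eps.
Proof.
move=> [dg <-] e0; move: dg => /cvgrPdist_lt /(_ eps e0).
move=> -[d /= d0 H]; exists d => // h h0 hd.
have /H/(_ h0) : ball_ Num.norm 0 d h by rewrite /= sub0r normrN.
by rewrite distrC /derive /GRing.scale /= mulr1 mulrC [h + x]addrC.
Qed.

Lemma derivable_is_derive1 g x : derivable g x 1 -> is_derive x 1 g (derive1 g x).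
Proof. by move=> dg; rewrite derive1E; exact: derivableP. Qed.

Lemma is_derive_derive1 g x l : is_derive x 1 g l -> derive1 g x = l.
Proof. by move=> [_ <-]; rewrite derive1E. Qed.

(** Only times before [t] are compared, so the conclusion is one-sided: this is
    what a maximum over a closed time interval gives at its right end. *)
Lemma is_derive_ge0_left_max g (T t l : R) : T < t -> is_derive t 1 g l ->
  (forall s, T <= s <= t -> g s <= g t) -> 0 <= l.
Proof.
move=> Tt dg gmax; rewrite leNgt; apply/negP => l0.
have [|d d0 H] := is_derive_eps (eps := - l) dg; first by rewrite oppr_gt0.
pose h := - (Num.min (d / 2) (t - T)).
have h0 : h < 0.
  by rewrite oppr_lt0 lt_min subr_gt0 Tt andbT divr_gt0.
have hd : `|h| < d.
  rewrite ltr0_norm// opprK; apply: (@le_lt_trans _ _ (d / 2)).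
    by rewrite ge_min lexx.
  lra.
have := H h (ltr0_neq0 h0) hd; rewrite ltr_norml => /andP[_].
suff : 0 <= (g (t + h) - g t) / h by lra.
rewrite -mulrNN mulr_ge0//.
  rewrite oppr_ge0 subr_le0 gmax//.
  have : - h <= t - T by rewrite opprK ge_min lexx orbT.
  lra.
by rewrite oppr_ge0 invr_le0 ltW.
Qed.

(** One-sided derivative at the origin: the form in which the Kirchhoff
    condition sees a function of the distance to a vertex. *)
Definition rderiv g l := (g h - g 0) / h @[h --> 0^'+] --> l.

Lemma rderivP g l : rderiv g l <-> (forall eps : R, 0 < eps ->
  exists2 d : R, 0 < d & forall h, 0 < h < d ->
    `|(g h - g 0) / h - l| < eps).
Proof.
split=> [/cvgrPdist_lt H eps e0|H].
  have [d /= d0 {}H] := H eps e0; exists d => // h /andP[h0 hd].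
  have /H/(_ h0) : ball_ Num.norm 0 d h by rewrite /= sub0r normrN gtr0_norm.
  by rewrite distrC.
apply/cvgrPdist_lt => eps e0; have [d d0 {}H] := H eps e0.
near=> h; have hd : 0 < h < d.
  by apply/andP; split; near: h; [exact: nbhs_right_gt|exact: nbhs_right_lt].
by rewrite distrC; exact: H.
Unshelve. all: by end_near. Qed.

Lemma rderiv_le0 g l (r : R) : 0 < r -> (forall h, 0 < h < r -> g h <= g 0) ->
  rderiv g l -> l <= 0.
Proof.
move=> r0 H /rderivP dg; rewrite leNgt; apply/negP => l0.
have [d d0 {}dg] := dg _ l0.
pose h := Num.min (d / 2) (r / 2).
have h0 : 0 < h by rewrite lt_min !divr_gt0.
have hd : h < d by rewrite gt_min; apply/orP; left; lra.
have hr : h < r by rewrite gt_min; apply/orP; right; lra.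
have := dg h; rewrite h0 hd => /(_ isT); rewrite ltr_norml => /andP[+ _].
suff : (g h - g 0) / h <= 0 by lra.
by rewrite mulr_le0_ge0 ?invr_ge0 ?(ltW h0)// subr_le0 H// h0.
Qed.

Lemma rderivD g k l m : rderiv g l -> rderiv k m ->
  rderiv (fun x => g x + k x) (l + m).
Proof.
rewrite /rderiv => dg dk.
rewrite (_ : (fun _ => _) = (fun h => (g h - g 0) / h + (k h - k 0) / h)).
  exact: cvgD.
by apply/funext => h; rewrite -mulrDl opprD addrACA.
Qed.

Lemma rderivZ g l (a : R) : rderiv g l -> rderiv (fun x => a * g x) (a * l).
Proof.
rewrite /rderiv => dg.
rewrite (_ : (fun _ => _) = (fun h => a * ((g h - g 0) / h))).
  by apply: cvgM => //; exact: cvg_cst.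
by apply/funext => h; rewrite mulrA mulrBr.
Qed.

Lemma is_derive_rderiv g l x : is_derive x 1 g l -> rderiv (fun h => g (x + h)) l.
Proof.
move=> dg; apply/rderivP => eps e0.
have [d d0 H] := is_derive_eps dg e0; exists d => // h /andP[h0 hd].
by rewrite addr0 H ?gt_eqF// gtr0_norm.
Qed.

Lemma is_derive_rderivN g l x : is_derive x 1 g l ->
  rderiv (fun h => g (x - h)) (- l).
Proof.
move=> dg; apply/rderivP => eps e0.
have [d d0 H] := is_derive_eps dg e0; exists d => // h /andP[h0 hd].
have := H (- h); rewrite oppr_eq0 gt_eqF// normrN gtr0_norm// hd => /(_ isT isT).
by rewrite subr0 opprK invrN mulrN -opprD normrN.
Qed.

(** Near [x] the sign of [k] is that of the increment, since [k] vanishes at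
    [x] with a positive derivative; the mean value theorem turns this into a
    strict local minimum of [g]. *)
Lemma strict_local_min g k x (r l : R) : 0 < r ->
  (forall y, `|y - x| < r -> is_derive y 1 g (k y)) ->
  k x = 0 -> is_derive x 1 k l -> 0 < l ->
  exists2 d : R, 0 < d & forall y, y != x -> `|y - x| < d -> g x < g y.
Proof.
move=> r0 dg kx0 dk l0.
have [d d0 H] := is_derive_eps dk l0.
have ksgn h : h != 0 -> `|h| < d -> 0 < k (x + h) / h.
  move=> h0 hd; have := H h h0 hd; rewrite kx0 subr0 ltr_norml => /andP[+ _].
  by lra.
have cg a b : `|a - x| < r -> `|b - x| < r -> {within `[a, b], continuous g}.
  move=> ax bx; apply: derivable_within_continuous => z.
  rewrite in_itv /= => /andP[az zb].
  have zx : `|z - x| < r by move: ax bx; rewrite !ltr_norml; lra.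
  by have [] := dg z zx.
exists (Num.min d r); first by rewrite lt_min d0.
move=> y yx; rewrite lt_min => /andP[yd yr].
have xr : `|x - x| < r by rewrite subrr normr0.
case: (ltgtP y x) yx => [yx _|xy _|//].
  have [|c] := MVT (f := g) (df := k) yx _ (cg _ _ yr xr).
    move=> z; rewrite in_itv /= => /andP[yz zx]; apply: dg.
    by move: yr; rewrite !ltr_norml; lra.
  rewrite in_itv /= => /andP[yc cx] E.
  have cx0 : c - x != 0 by rewrite subr_eq0 lt_eqF.
  have cd : `|c - x| < d by move: yd; rewrite !ltr_norml; lra.
  have := ksgn _ cx0 cd; rewrite addrC subrK => kc.
  have : k c < 0.
    have -> : k c = k c / (c - x) * (c - x) by field.
    by rewrite pmulr_rlt0// subr_lt0.
  by nra.
have [|c] := MVT (f := g) (df := k) xy _ (cg _ _ xr yr).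
  move=> z; rewrite in_itv /= => /andP[xz zy]; apply: dg.
  by move: yr; rewrite !ltr_norml; lra.
rewrite in_itv /= => /andP[xc cy] E.
have cx0 : c - x != 0 by rewrite subr_eq0 gt_eqF.
have cd : `|c - x| < d by move: yd; rewrite !ltr_norml; lra.
have := ksgn _ cx0 cd; rewrite addrC subrK => kc.
have : 0 < k c.
  have -> : k c = k c / (c - x) * (c - x) by field.
  by rewrite mulr_gt0// subr_gt0.
by nra.
Qed.

Lemma local_max_deriv0 g x (r l : R) : 0 < r -> is_derive x 1 g l ->
  (forall y, `|y - x| < r -> g y <= g x) -> l = 0.
Proof.
move=> r0 dg H; apply/eqP; rewrite eq_le; apply/andP; split.
  apply: (rderiv_le0 r0 _ (is_derive_rderiv dg)) => h /andP[h0 hr].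
  by rewrite addr0 H// addrAC subrr add0r gtr0_norm.
rewrite -oppr_le0.
apply: (rderiv_le0 r0 _ (is_derive_rderivN dg)) => h /andP[h0 hr].
by rewrite subr0 H// addrAC subrr add0r normrN gtr0_norm.
Qed.

(** The second derivative is only assumed at [x] itself, as for the solutions
    of the equation, whose second derivatives need not be continuous. *)
Lemma second_order_max g k x (r l : R) : 0 < r ->
  (forall y, `|y - x| < r -> is_derive y 1 g (k y)) -> is_derive x 1 k l ->
  (forall y, `|y - x| < r -> g y <= g x) -> l <= 0.
Proof.
move=> r0 dg dk H; rewrite leNgt; apply/negP => l0.
have dgx : is_derive x 1 g (k x) by apply: dg; rewrite subrr normr0.
have kx0 := local_max_deriv0 r0 dgx H.
have [d d0 Hm] := strict_local_min r0 dg kx0 dk l0.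
pose y := x + Num.min (d / 2) (r / 2).
have m0 : 0 < Num.min (d / 2) (r / 2) by rewrite lt_min !divr_gt0.
have yd : `|y - x| < d.
  rewrite /y addrAC subrr add0r gtr0_norm// gt_min; apply/orP; left; lra.
have yr : `|y - x| < r.
  rewrite /y addrAC subrr add0r gtr0_norm// gt_min; apply/orP; right; lra.
have yx : y != x by rewrite gt_eqF// /y ltrDl.
by have := H y yr; rewrite leNgt Hm.
Qed.

Lemma eps_is_derive g x l : (forall eps : R, 0 < eps ->
    exists2 d : R, 0 < d & forall h, h != 0 -> `|h| < d ->
      `|(g (x + h) - g x) / h - l| < eps) -> is_derive x 1 g l.
Proof.
move=> H.
have cg : h^-1 *: (g (h *: (1 : R) + x) - g x) @[h --> 0^'] --> l.
  apply/cvgrPdist_lt => eps e0; have [d d0 Hd] := H eps e0.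
  exists d => // h; rewrite /= sub0r normrN => hd h0.
  by rewrite distrC /GRing.scale /= mulr1 mulrC [h + x]addrC Hd.
by apply: DeriveDef; [apply/cvg_ex; exists l|exact/cvg_lim].
Qed.

Lemma is_derive_near g k x l (r : R) : 0 < r ->
  (forall y, `|y - x| < r -> g y = k y) -> is_derive x 1 k l -> is_derive x 1 g l.
Proof.
move=> r0 gk dk; apply: eps_is_derive => eps e0.
have [d d0 H] := is_derive_eps dk e0; exists (Num.min d r); first by rewrite lt_min d0.
move=> h h0; rewrite lt_min => /andP[hd hr].
by rewrite !gk ?subrr ?normr0 ?H// addrAC subrr add0r.
Qed.

Lemma is_derive_shift g x y l : is_derive (x - y) 1 g l ->
  is_derive x 1 (fun z => g (z - y)) l.
Proof.
move=> dg; apply: eps_is_derive => eps e0.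
have [d d0 H] := is_derive_eps dg e0; exists d => // h h0 hd.
by rewrite (addrAC x h) H.
Qed.

Lemma continuous_is_derive g k : (forall x, is_derive x 1 g (k x)) -> continuous g.
Proof.
by move=> dg x; apply/differentiable_continuous/derivable1_diffP; have [] := dg x.
Qed.

Lemma is_derive_addf g k x l m : is_derive x 1 g l -> is_derive x 1 k m ->
  is_derive x 1 (fun y => g y + k y) (l + m).
Proof. exact: is_deriveD. Qed.

Lemma is_derive_oppf g x l : is_derive x 1 g l -> is_derive x 1 (fun y => - g y) (- l).
Proof. exact: is_deriveN. Qed.

Lemma is_derive_subf g k x l m : is_derive x 1 g l -> is_derive x 1 k m ->
  is_derive x 1 (fun y => g y - k y) (l - m).
Proof. exact: is_deriveB. Qed.

Lemma is_derive_mulf g k x l m : is_derive x 1 g l -> is_derive x 1 k m ->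
  is_derive x 1 (fun y => g y * k y) (l * k x + g x * m).
Proof.
move=> dg dk; apply: is_derive_eq (is_deriveM dg dk) _.
by rewrite /GRing.scale /= addrC (mulrC l).
Qed.

Lemma is_derive_scalef a g x l : is_derive x 1 g l -> is_derive x 1 (fun y => a * g y) (a * l).
Proof. by move=> dg; apply: (is_deriveZ (f := g)). Qed.

Lemma is_derive_affine a b c x : is_derive x 1 (fun y => a + b * (y - c)) b.
Proof.
rewrite -[X in is_derive _ _ _ X]add0r; apply: is_derive_addf.
rewrite -[X in is_derive _ _ _ X]mulr1; apply: is_derive_scalef.
by rewrite -[X in is_derive _ _ _ X]subr0; apply: is_derive_subf.
Qed.

Lemma is_derive_parabola a b d c x :
  is_derive x 1 (fun y => a + b * (y - c) + d / 2 * (y - c) ^+ 2) (b + d * (x - c)).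
Proof.
have -> : (fun y => a + b * (y - c) + d / 2 * (y - c) ^+ 2) =
   (fun y => a + b * (y - c) + d / 2 * (y - c) * (y - c)).
  by apply/funext => y; rewrite expr2 mulrA.
apply: is_derive_addf; first exact: is_derive_affine.
have lin e f : is_derive x 1 (fun y => f + e * (y - c)) e by exact: is_derive_affine.
have H := is_derive_mulf (lin (d / 2) 0) (lin 1 0).
have -> : (fun y => d / 2 * (y - c) * (y - c)) =
  (fun y => (0 + d / 2 * (y - c)) * (0 + 1 * (y - c))).
  by apply/funext => y; rewrite !add0r mul1r.
by apply: is_derive_eq H _; field.
Qed.

Lemma is_derive_reflect (g : R -> R) (c y g' : R) : is_derive (c - y) 1 g g' ->
  is_derive y 1 (fun z => g (c - z)) (- g').
Proof.
move=> dg; apply: eps_is_derive => eps e0; have [d d0 H] := is_derive_eps dg e0.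
exists d => // h h0 hd; have := H (- h); rewrite oppr_eq0 normrN => /(_ h0 hd).
by rewrite invrN mulrN -opprD normrN opprK opprD addrA.
Qed.

Lemma is_derive_expR_scaled (c T t : R) :
  is_derive t 1 (fun s => expR (c * (s - T))) (c * expR (c * (t - T))).
Proof.
have d1 : is_derive t 1 (fun s => c * (s - T)) c.
  have := is_derive_affine 0 c T t.
  by rewrite (_ : (fun y => 0 + c * (y - T)) = (fun y => c * (y - T)))//;
    apply/funext => y; rewrite add0r.
by rewrite mulrC; exact: (is_derive1_comp (is_derive_expR _) d1).
Qed.

Lemma expR_decay (a b T eps : R) : 0 < a -> 0 < b -> 0 < eps ->
  exists T' : R, forall t, T' <= t -> b * expR (- a * (t - T)) <= eps.
Proof.
move=> a0 b0 e0; exists (T + b / (a * eps)) => t Tt.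
rewrite mulNr expRN ler_pdivrMr ?expR_gt0// -ler_pdivrMl//.
apply: le_trans (expR_ge1Dx _).
suff : eps^-1 * b <= a * (t - T) by lra.
rewrite -ler_pdivrMl//; have : b / (a * eps) <= t - T by lra.
have -> : a^-1 * (eps^-1 * b) = b / (a * eps) by field; rewrite !gt_eqF.
by [].
Qed.

Lemma rderiv_eq (g k : R -> R) l m : rderiv g l -> l = m -> g =1 k -> rderiv k m.
Proof. by move=> dg <- /funext <-. Qed.

Lemma rderiv_sum (I : finType) (F : I -> R -> R) (l : I -> R) :
  (forall j, rderiv (F j) (l j)) -> rderiv (fun x => \sum_j F j x) (\sum_j l j).
Proof.
move=> dF; elim: (index_enum I) => [|j s IH].
  rewrite big_nil; apply: (rderiv_eq (is_derive_rderiv (is_derive_cst 0 (0 : R) 1))) => //.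
  by move=> x /=; rewrite big_nil.
rewrite big_cons; apply: (rderiv_eq (rderivD (dF j) IH)) => // x.
by rewrite big_cons.
Qed.

End OneVariable.

Section Continuity.
Variable R : realType.

Lemma within_comp (S T : topologicalType) (D : set T) (D' : set S) (g : T -> R)
    (h : S -> T) : continuous h -> (forall q, D' q -> D (h q)) ->
  {within D, continuous g} -> {within D', continuous (g \o h)}.
Proof.
move=> ch hD /subspace_continuousP cg; apply/subspace_continuousP => q Dq A nA.
have H : nbhs (h q) [set y | D y -> A (g y)] := cg _ (hD _ Dq) A nA.
suff : nbhs q [set z | D' z -> A (g (h z))] by [].
have H2 : nbhs q [set z | D (h z) -> A (g (h z))] := ch q _ H.
by apply: filterS H2 => z Hz /hD; exact: Hz.
Qed.

Lemma continuous_shift_snd (a b : R) :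
  continuous (fun p : R * R => (p.1, a + b * p.2)).
Proof.
move=> p.
have c1 : {for p, continuous (@fst R R)} by exact: cvg_fst.
have c2 : {for p, continuous (fun q : R * R => a + b * q.2)}.
  by apply: cvgD; [exact: cvg_cst|apply: cvgM; [exact: cvg_cst|exact: cvg_snd]].
have F0 : Filter (nbhs p) by exact: nbhs_filter.
have F1 : Filter (nbhs p.1) by exact: nbhs_filter.
have F2 : Filter (nbhs (a + b * p.2)) by exact: nbhs_filter.
have := cvg_pair c1 c2; exact.
Qed.

Lemma within_snd (D : set R) (g : R -> R) : {within D, continuous g} ->
  {within [set p : R * R | D p.2], continuous (fun p => g p.2)}.
Proof.
move=> /subspace_continuousP cg; apply/subspace_continuousP => p Dp A nA.
have H : nbhs p.2 [set y | D y -> A (g y)] := cg _ Dp A nA.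
have cs : {for p, continuous (@snd R R)} by exact: cvg_snd.
exact: (cs _ H).
Qed.

Lemma continuous_fst_comp (g : R -> R) : continuous g ->
  continuous (fun p : R * R => g p.1).
Proof. by move=> cg p; apply: continuous_comp; [exact: cvg_fst|exact: cg]. Qed.

Lemma continuous_snd_comp (g : R -> R) : continuous g ->
  continuous (fun p : R * R => g p.2).
Proof. by move=> cg p; apply: continuous_comp; [exact: cvg_snd|exact: cg]. Qed.

End Continuity.

Section Antiderivatives.
Variable R : realType.

Lemma lipschitz_within (D : set R) (g : R -> R) (K : R) : 0 <= K ->
  (forall x y, D x -> D y -> `|g x - g y| <= K * `|x - y|) ->
  {within D, continuous g}.
Proof.
move=> K0 H; apply/subspace_continuousP => x Dx; apply/cvgrPdist_lt => eps e0.
have K1 : 0 < K + 1 by rewrite ltr_wpDl.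
exists (eps / (K + 1)) => /=; first by rewrite divr_gt0.
move=> y /= xy Dy; apply: (le_lt_trans (H x y Dx Dy)).
apply: (@le_lt_trans _ _ ((K + 1) * `|x - y|)).
  by rewrite ler_wpM2r// lerDl.
by rewrite mulrC -ltr_pdivlMr.
Qed.

Lemma antiderivative_from (g : R -> R) (a : R) : continuous g ->
  exists G : R -> R, forall x : R, a < x -> is_derive x 1 G (g x).
Proof.
move=> cg; exists (fun x => \int[lebesgue_measure]_(t in [set` `[a, x]]) g t) => x ax.
have xx : x < x + 1 by rewrite ltrDl.
have int : lebesgue_measure.-integrable `[a, x + 1] (EFin \o g).
  apply: continuous_compact_integrable; first exact: segment_compact.
  exact: continuous_subspaceT.
have [d E] := continuous_FTC1_closed xx int ax (cg x).
by rewrite -E; exact: derivable_is_derive1.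
Qed.

(** Differentiable in a neighbourhood of [0, +oo[, hence also at the ends of the
    edges. *)
Lemma second_antiderivative (g : R -> R) : continuous g ->
  exists F F1 : R -> R, forall x : R, -1 < x ->
    is_derive x 1 F (F1 x) /\ is_derive x 1 F1 (g x).
Proof.
move=> cg; have [F1 dF1] := antiderivative_from (-3) cg.
have cF1 : continuous (fun x : R => F1 (Num.max x (-2))).
  move=> x; apply: (@continuous_comp _ _ _ (fun x : R => Num.max x (-2)) F1).
    by apply: continuous_max; [exact: cvg_id|exact: cvg_cst].
  have m3 : -3 < Num.max x (-2) by rewrite lt_max; apply/orP; right; lra.
  by apply/differentiable_continuous/derivable1_diffP; have [] := dF1 _ m3.
have [F dF] := antiderivative_from (-2) cF1.
exists F, F1 => x x1; split; last by apply: dF1; lra.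
have := dF x; rewrite (max_idPl _); first by apply; lra.
lra.
Qed.

Lemma segment_bounded (g : R -> R) (a b : R) : a <= b ->
  {within `[a, b], continuous g} -> exists B : R, forall x, a <= x <= b -> `|g x| <= B.
Proof.
move=> ab cg; have cn : {within `[a, b], continuous (fun x => `|g x|)}.
  by move=> x; apply: cvg_norm; exact: cg.
have [c _ cmax] := EVT_max ab cn.
by exists `|g c| => x xab; apply: cmax; rewrite in_itv.
Qed.

End Antiderivatives.

(** * Bump functions for the weak formulation *)

Section TestFunctions.
Variable R : realType.
Implicit Types (g k : R -> R) (x l s h : R).

Definition pospow n x := (Num.max x 0) ^+ n.

Lemma pospow_le0 n x : x <= 0 -> pospow n.+1 x = 0.
Proof. by move=> x0; rewrite /pospow (max_idPr _)// expr0n. Qed.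

Lemma pospow_ge0 n x : 0 <= x -> pospow n x = x ^+ n.
Proof. by move=> x0; rewrite /pospow (max_idPl _). Qed.

Lemma is_derive_pospow n x :
  is_derive x 1 (pospow n.+2) (n.+2%:R * pospow n.+1 x).
Proof.
case: (ltgtP x 0) => x0.
- apply: (@is_derive_near _ _ (fun _ => 0) _ _ (- x)); first by rewrite oppr_gt0.
    by move=> y; rewrite ltr_norml => /andP[_ yx]; apply: pospow_le0; lra.
  by rewrite pospow_le0 ?mulr0; [exact: is_derive_cst|exact: ltW].
- apply: (@is_derive_near _ _ (fun y => y ^+ n.+2) _ _ x) => //.
    by move=> y; rewrite ltr_norml => /andP[xy _]; apply: pospow_ge0; lra.
  rewrite pospow_ge0 ?ltW//.
  have -> : (fun y : R => y ^+ n.+2) = (id : R -> R) ^+ n.+2.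
    by apply/funext => y; rewrite exprfctE.
  apply: is_derive_eq (is_deriveX n.+2 (is_derive_id x 1)) _.
  by rewrite /GRing.scale /= mulr1.
- rewrite x0 pospow_le0// mulr0; apply: eps_is_derive => eps e0.
  exists (Num.min 1 eps); first by rewrite lt_min ltr01.
  move=> h h0; rewrite lt_min => /andP[h1 he].
  rewrite add0r (pospow_le0 n.+1 (lexx 0)) !subr0.
  case: (leP h 0) => h0'; first by rewrite pospow_le0// mul0r normr0.
  rewrite pospow_ge0 ?ltW// exprSr mulfK// normrX (le_lt_trans _ he)//.
  by rewrite exprS ler_piMr// exprn_ile1// ltW.
Qed.

Definition diff2 s g x := g (x + s) - 2 * g x + g (x - s).

Lemma is_derive_diff2 s g k : (forall x, is_derive x 1 g (k x)) ->
  forall x, is_derive x 1 (diff2 s g) (diff2 s k x).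
Proof.
move=> dg x; rewrite /diff2.
have d1 : is_derive x 1 (fun y => g (y + s)) (k (x + s)).
  by rewrite -[s]opprK; apply: is_derive_shift.
have d2 : is_derive x 1 (fun y => g (y - s)) (k (x - s)).
  by apply: is_derive_shift.
have d3 : is_derive x 1 (fun y => 2 * g y) (2 * k x).
  by apply: (@is_deriveZ _ _ _ g 2).
by apply: is_deriveD.
Qed.

Lemma continuous_pospow1 : continuous (pospow 1).
Proof.
move=> x; rewrite /pospow /=.
by under eq_fun do rewrite expr1; apply: continuous_max; [exact: cvg_id|exact: cvg_cst].
Qed.

Lemma continuous_diff2 s g : continuous g -> continuous (diff2 s g).
Proof.
move=> cg x; rewrite /diff2; apply: cvgD; last first.
  by apply: continuous_comp; [apply: cvgB; [exact: cvg_id|exact: cvg_cst]|exact: cg].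
apply: cvgB.
  by apply: continuous_comp; [apply: cvgD; [exact: cvg_id|exact: cvg_cst]|exact: cg].
by apply: cvgM; [exact: cvg_cst|exact: cg].
Qed.

(** The hat function of half-width [s], up to the factor [s ^+ 2]. *)
Definition hat s := diff2 s (pospow 1).

Lemma hat_ge0 s x : 0 < s -> 0 <= hat s x.
Proof.
move=> s0; rewrite /hat /diff2 /pospow !expr1 /Num.max.
by do !case: ifPn => //; rewrite -?leNgt; lra.
Qed.

Lemma hat_eq0 s x : 0 < s -> s <= `|x| -> hat s x = 0.
Proof.
move=> s0; rewrite ler_normr /hat /diff2 /pospow !expr1 /Num.max => /orP[] ?;
by do !case: ifPn => //; rewrite -?leNgt; lra.
Qed.

(** The function [bump s h 3] is nonnegative and supported in [-(h+s), h+s];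
    its second derivative [6 * bump s h 1] consists of a hat at each of [h] and
    [-h], and of minus twice such a hat at the origin.  For small [s] it tests
    the second difference with step [h]. *)
Definition bump s h n := diff2 h (diff2 s (pospow n)).

Lemma is_derive_bump s h n x :
  is_derive x 1 (bump s h n.+2) (n.+2%:R * bump s h n.+1 x).
Proof.
have -> : n.+2%:R * bump s h n.+1 x =
    diff2 h (diff2 s (fun y => n.+2%:R * pospow n.+1 y)) x.
  by rewrite /bump /diff2; ring.
do 2 (move: x; apply: is_derive_diff2) => x; exact: is_derive_pospow.
Qed.

Lemma bump1E s h x : bump s h 1 x = hat s (x + h) - 2 * hat s x + hat s (x - h).
Proof. by []. Qed.

Lemma diff2_convex g k h : 0 < h -> (forall x, is_derive x 1 g (k x)) ->
  (forall x y, x <= y -> k x <= k y) -> forall x, 0 <= diff2 h g x.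
Proof.
move=> h0 dg kmono x; rewrite /diff2.
have cg a b : {within `[a, b], continuous g}.
  exact/continuous_subspaceT/(continuous_is_derive dg).
have xh : x < x + h by lra.
have [|c] := MVT xh (fun z _ => dg z); first exact: cg.
rewrite in_itv /= => /andP[xc _] E1.
have hx : x - h < x by lra.
have [|c'] := MVT hx (fun z _ => dg z); first exact: cg.
rewrite in_itv /= => /andP[_ c'x] E2.
have := kmono c' c; nra.
Qed.

(** A second difference of a function whose second derivative, a hat, is
    nonnegative. *)
Lemma bump3_ge0 s h x : 0 < s -> 0 < h -> 0 <= bump s h 3 x.
Proof.
move=> s0 h0; apply: (@diff2_convex _ (diff2 s (fun y => 3 * pospow 2 y))) => //.
  by apply: is_derive_diff2 => y; exact: is_derive_pospow.
move=> y z yz.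
have dk (w : R) : is_derive w 1 (diff2 s (fun y => 3 * pospow 2 y)) (6 * hat s w).
  have -> : 6 * hat s w = diff2 s (fun y => 3 * (2 * pospow 1 y)) w.
    by rewrite /hat /diff2; ring.
  move: w; apply: is_derive_diff2 => w.
  by apply: (@is_deriveZ _ _ _ (pospow 2) 3); exact: is_derive_pospow.
move: yz; rewrite le_eqVlt => /orP[/eqP->//|yz].
have [|c _ E] := MVT yz (fun w _ => dk w).
  exact/continuous_subspaceT/(continuous_is_derive dk).
rewrite -subr_ge0 E mulr_ge0 ?subr_ge0 ?(ltW yz)//.
by rewrite mulr_ge0// hat_ge0.
Qed.

Lemma bump_left s h n x : 0 < s -> 0 < h -> x <= - (h + s) -> bump s h n.+1 x = 0.
Proof.
by move=> s0 h0 xhs; rewrite /bump /diff2 !pospow_le0 //; lra.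
Qed.

Lemma diff2_right s g x : 0 < s -> s <= x -> forall n,
   diff2 s (pospow n) x = (x + s) ^+ n - 2 * x ^+ n + (x - s) ^+ n.
Proof. by move=> s0 sx n; rewrite /diff2 !pospow_ge0//; lra. Qed.

Lemma bump_right s h x : 0 < s -> 0 < h -> h + s <= x ->
  [/\ bump s h 1 x = 0, bump s h 2 x = 0, bump s h 3 x = 0 &
      bump s h 4 x = 24 * s ^+ 2 * h ^+ 2].
Proof.
move=> s0 h0 xhs; rewrite /bump /diff2 !pospow_ge0; try lra.
by split; ring.
Qed.

End TestFunctions.

(** * Parabolas touching a weak supersolution *)

Section WeakTouching.
Variables (R : realType) (Om : star_graph R) (f : R -> R).

Lemma edge_int_open (e : edge Om) (x : R) : x \in edge_int e ->
  exists2 r : R, 0 < r & forall y, `|y - x| < r -> y \in edge_int e.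
Proof.
case: e => [e|j] /=; rewrite in_itv /= ?andbT => H.
  move/andP: H => [x0 xL]; exists (Num.min x (clen e - x)).
    by rewrite lt_min x0 subr_gt0.
  move=> y; rewrite lt_min !ltr_norml in_itv /= => /andP[/andP[? ?] /andP[? ?]].
  by apply/andP; split; lra.
exists x => // y; rewrite ltr_norml in_itv /= andbT; lra.
Qed.

Lemma edge_int_dom (e : edge Om) (x : R) : x \in edge_int e -> x \in edge_dom e.
Proof.
case: e => [e|j] /=; rewrite !in_itv /= ?andbT; last exact: ltW.
by move=> /andP[/ltW-> /ltW->].
Qed.

Lemma continuous_on_interior (e : edge Om) (g : R -> R) :
  {within [set` edge_dom e], continuous g} ->
  forall x, x \in edge_int e -> {for x, continuous g}.
Proof.
move=> cg x xe.
have : {within [set` edge_int e], continuous g}.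
  by apply: continuous_subspaceW cg => y; exact: edge_int_dom.
rewrite continuous_open_subspace; first by apply; rewrite inE.
by case: (e) => [e'|j] /=; exact: interval_open.
Qed.

(** Test the weak inequality against a bump whose second derivative is a hat of
    width [s] at the distance [h] on either side of [x0], where [v] exceeds the
    parabola, and minus two such hats at [x0], where [v] minus the parabola is
    as small as wanted once [s] is small.  The contribution of the parabola
    itself is that of a primitive vanishing at both ends. *)
Lemma super_weak_touch (e : edge Om) (v : R -> R) (x0 r alpha kappa : R) :
  continuous f -> {within [set` edge_dom e], continuous v} ->
  super_weak f e v -> x0 \in edge_int e -> 0 < r ->
  (forall x, `|x - x0| < r ->
     v x0 + alpha * (x - x0) + kappa / 2 * (x - x0) ^+ 2 <= v x) ->
  kappa + f (v x0) <= 0.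
Proof.
move=> cf cv vw x0e r0 Hq; rewrite leNgt; apply/negP => kpos.
have cvi := continuous_on_interior cv.
have cfv x : x \in edge_int e -> {for x, continuous (f \o v)}.
  by move=> xe; apply: continuous_comp; [exact: cvi|exact: cf].
pose eta := (kappa + f (v x0)) / 2.
have eta0 : 0 < eta by rewrite divr_gt0.
have [rI rI0 HI] := edge_int_open x0e.
have [rf rf0 Hf] : exists2 d : R, 0 < d &
    forall x, `|x - x0| < d -> eta <= kappa + f (v x).
  have /cvgrPdist_lt/(_ eta eta0) [d /= d0 H] := cfv _ x0e.
  exists d => // x xd; have /H : ball_ Num.norm x0 d x by rewrite /= distrC.
  by rewrite /= ltr_norml /eta => /andP[_]; lra.
pose r1 := Num.min r (Num.min rI rf).
have r10 : 0 < r1 by rewrite !lt_min r0 rI0.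
have r1r x : `|x - x0| < r1 ->
   [/\ `|x - x0| < r, `|x - x0| < rI & `|x - x0| < rf].
  by rewrite !lt_min => /and3P[].
pose Q x := v x0 + alpha * (x - x0) + kappa / 2 * (x - x0) ^+ 2.
pose Q1 x := alpha + kappa * (x - x0).
have dQ (x : R) : is_derive x 1 Q (Q1 x) by exact: is_derive_parabola.
have dQ1 (x : R) : is_derive x 1 Q1 kappa by exact: is_derive_affine.
pose h := r1 / 2.
have h0 : 0 < h by rewrite divr_gt0.
pose w := eta * h ^+ 2 / 4.
have w0 : 0 < w by rewrite divr_gt0// mulr_gt0// exprn_gt0.
have [d d0 Hd] : exists2 d : R, 0 < d & forall x, `|x - x0| < d -> v x - Q x <= w.
  have cvQ : {for x0, continuous (fun x => v x - Q x)}.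
    by apply: cvgB; [exact: cvi|exact: (continuous_is_derive dQ)].
  have /cvgrPdist_lt/(_ w w0) [d /= d0 H] := cvQ.
  exists d => // x xd; have /H : ball_ Num.norm x0 d x by rewrite /= distrC.
  have Qx0 : Q x0 = v x0 by rewrite /Q subrr expr0n /= !mulr0 !addr0.
  by rewrite /= Qx0 subrr sub0r normrN => /(le_lt_trans (ler_norm _))/ltW.
pose s := Num.min d (r1 / 8).
have s0 : 0 < s by rewrite lt_min d0 divr_gt0.
have sd : s <= d by rewrite ge_min lexx.
have sr1 : s <= r1 / 8 by rewrite ge_min lexx orbT.
have s2 : s ^+ 2 != 0 by rewrite expf_neq0// gt_eqF.
pose c3 := (6 * s ^+ 2)^-1.
have c30 : 0 < c3 by rewrite invr_gt0 mulr_gt0// exprn_gt0.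
pose psi x := c3 * bump s h 3 (x - x0).
pose psi1 x := 3 * c3 * bump s h 2 (x - x0).
pose psi2 x := 6 * c3 * bump s h 1 (x - x0).
pose psi_1 x := c3 / 4 * bump s h 4 (x - x0).
have dsh n (x : R) : is_derive x 1 (fun y => bump s h n.+2 (y - x0))
    (n.+2%:R * bump s h n.+1 (x - x0)).
  by apply: is_derive_shift; exact: is_derive_bump.
have dpsi (x : R) : is_derive x 1 psi (psi1 x).
  have -> : psi1 x = c3 * (3 * bump s h 2 (x - x0)) by rewrite /psi1; ring.
  by apply: is_derive_scalef; exact: dsh.
have dpsi1 (x : R) : is_derive x 1 psi1 (psi2 x).
  have -> : psi2 x = 3 * c3 * (2 * bump s h 1 (x - x0)) by rewrite /psi2; ring.
  by apply: is_derive_scalef; exact: dsh.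
have dpsi_1 (x : R) : is_derive x 1 psi_1 (psi x).
  have -> : psi x = c3 / 4 * (4 * bump s h 3 (x - x0)) by rewrite /psi; field.
  by apply: is_derive_scalef; exact: dsh.
have psi1E : derive1 psi = psi1.
  by apply/funext => x; exact: is_derive_derive1.
have psi2E : derive1 psi1 = psi2.
  by apply/funext => x; exact: is_derive_derive1.
have cshift (g : R -> R) : continuous g -> continuous (fun x => g (x - x0)).
  move=> cg x; apply: continuous_comp; last exact: cg.
  by apply: cvgB; [exact: cvg_id|exact: cvg_cst].
have cpsi2 : continuous psi2.
  move=> x; apply: cvgM; first exact: cvg_cst.
  apply: (cshift (bump s h 1)) => y.
  exact/continuous_diff2/continuous_diff2/continuous_pospow1.
have psi0 x : 0 <= psi x by rewrite mulr_ge0 ?(ltW c30)// bump3_ge0.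
pose a := x0 - 3 / 4 * r1; pose b := x0 + 3 / 4 * r1.
have hsr : h + s <= 3 / 4 * r1 by rewrite /h; lra.
have ab : a < b by rewrite /a /b; lra.
have abr x : x \in `[a, b] -> `|x - x0| < r1.
  by rewrite in_itv /= ltr_norml /a /b => /andP[? ?]; lra.
have zl x : x <= a -> [/\ psi x = 0, psi1 x = 0, psi2 x = 0 & psi_1 x = 0].
  move=> xa; have xhs : x - x0 <= - (h + s) by rewrite /a in xa; lra.
  by split; rewrite /psi /psi1 /psi2 /psi_1 bump_left ?mulr0.
have zr x : b <= x -> [/\ psi x = 0, psi1 x = 0, psi2 x = 0 & psi_1 x = h ^+ 2].
  move=> bx; have xhs : h + s <= x - x0 by rewrite /b in bx; lra.
  have [E1 E2 E3 E4] := bump_right s0 h0 xhs.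
  split; rewrite /psi /psi1 /psi2 /psi_1 ?E1 ?E2 ?E3 ?E4 ?mulr0// /c3.
  by field; rewrite gt_eqF.
have zout x : x \notin `[a, b] -> psi x = 0 /\ psi2 x = 0.
  rewrite in_itv /= negb_and -!ltNge => /orP[/ltW/zl[-> _ -> _]//|/ltW/zr[-> _ -> _]//].
have := vw psi; rewrite /derive1n /= psi1E psi2E.
have tw x : twice_derivable psi x.
  by split; [have [] := dpsi x|rewrite psi1E; have [] := dpsi1 x].
have ae : a \in edge_int e.
  by apply: HI; have [] := r1r a _; first by apply: abr; rewrite in_itv /= lexx ltW.
have be : b \in edge_int e.
  by apply: HI; have [] := r1r b _; first by apply: abr; rewrite in_itv /= lexx ltW.
have supp : exists a0 b0, [/\ a0 \in edge_int e, b0 \in edge_int e &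
    forall x, x \notin `[a0, b0] -> psi x = 0].
  by exists a, b; split=> // x /zout[].
move=> /(_ tw cpsi2 psi0 supp); apply/negP; rewrite -ltNge.
pose J x := v x * psi2 x + f (v x) * psi x.
have abD : [set` `[a, b]] `<=` [set` edge_dom e].
  by move=> x /abr/r1r[_ /HI xe _]; apply: edge_int_dom.
(* the weak inequality integrates over the whole edge *)
have -> : \int[lebesgue_measure]_(x in [set` edge_dom e]) J x =
   \int[lebesgue_measure]_(x in `[a, b]) J x.
  rewrite -[in RHS](setIidr abD) Rintegral_mkcondr; apply: eq_Rintegral => x _.
  rewrite patchE; case: ifPn => // xab.
  have /zout[p0 p20] : x \notin `[a, b] by move: xab; rewrite mem_setE.
  by rewrite /J p0 p20 !mulr0 addr0.
(* [J] dominates [th], whose primitive [Th] is explicit: on the support of the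
   middle hat, [v - Q <= w]; elsewhere [psi2] is nonnegative *)
pose th x := - 2 * w * (s ^+ 2)^-1 * hat s (x - x0) +
   (Q x * psi2 x - kappa * psi x) + eta * psi x.
pose Th x := - 2 * w * (s ^+ 2)^-1 / 2 * diff2 s (pospow 2) (x - x0) +
   (Q x * psi1 x - Q1 x * psi x) + eta * psi_1 x.
have dTh (x : R) : is_derive x 1 Th (th x).
  have d1 : is_derive x 1 (fun y => - 2 * w * (s ^+ 2)^-1 / 2 * diff2 s (pospow 2) (y - x0))
      (- 2 * w * (s ^+ 2)^-1 * hat s (x - x0)).
    have -> : - 2 * w * (s ^+ 2)^-1 * hat s (x - x0) =
        - 2 * w * (s ^+ 2)^-1 / 2 * diff2 s (fun y => 2 * pospow 1 y) (x - x0).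
      by rewrite /hat /diff2; field; rewrite gt_eqF.
    apply: is_derive_scalef; apply: is_derive_shift; apply: is_derive_diff2 => y.
    exact: is_derive_pospow.
  have d2 : is_derive x 1 (fun y => Q y * psi1 y - Q1 y * psi y)
      (Q x * psi2 x - kappa * psi x).
    have -> : Q x * psi2 x - kappa * psi x =
      (Q1 x * psi1 x + Q x * psi2 x) - (kappa * psi x + Q1 x * psi1 x) by ring.
    exact: is_derive_subf (is_derive_mulf (dQ x) (dpsi1 x)) (is_derive_mulf (dQ1 x) (dpsi x)).
  exact: is_derive_addf (is_derive_addf d1 d2) (is_derive_scalef eta (dpsi_1 x)).
have cth : continuous th.
  have cpsi := continuous_is_derive dpsi; have cQ := continuous_is_derive dQ.
  move=> x; apply: cvgD; last by apply: cvgM; [exact: cvg_cst|exact: cpsi].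
  apply: cvgD.
    apply: cvgM; first exact: cvg_cst.
    by apply: (cshift (hat s)); apply: continuous_diff2; exact: continuous_pospow1.
  apply: cvgB; first by apply: cvgM; [exact: cQ|exact: cpsi2].
  by apply: cvgM; [exact: cvg_cst|exact: cpsi].
have thJ x : `[a, b]%classic x -> th x <= J x.
  move=> /= /abr xr1; have [xr xI xf] := r1r _ xr1.
  pose g := v x - Q x.
  have g0 : 0 <= g by rewrite subr_ge0 Hq.
  have -> : J x = g * psi2 x + (Q x * psi2 x - kappa * psi x) +
     (kappa + f (v x)) * psi x by rewrite /J /g; ring.
  apply: lerD; last by rewrite ler_wpM2r// Hf.
  rewrite lerD2r /psi2 bump1E.
  have -> : 6 * c3 = (s ^+ 2)^-1 by rewrite /c3; field; rewrite gt_eqF.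
  have gw : g * hat s (x - x0) <= w * hat s (x - x0).
    case: (ltP `|x - x0| s) => xs; last by rewrite hat_eq0// !mulr0.
    by rewrite ler_wpM2r ?hat_ge0// Hd// (lt_le_trans xs).
  have g1 := mulr_ge0 g0 (hat_ge0 (x - x0 + h) s0).
  have g2 := mulr_ge0 g0 (hat_ge0 (x - x0 - h) s0).
  have -> : - 2 * w * (s ^+ 2)^-1 * hat s (x - x0) =
    (s ^+ 2)^-1 * (- 2 * (w * hat s (x - x0))) by ring.
  have -> : g * ((s ^+ 2)^-1 * (hat s (x - x0 + h) - 2 * hat s (x - x0) +
    hat s (x - x0 - h))) = (s ^+ 2)^-1 * (g * hat s (x - x0 + h) -
      2 * (g * hat s (x - x0)) + g * hat s (x - x0 - h)) by ring.
  apply: ler_wpM2l; first by rewrite invr_ge0 sqr_ge0.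
  lra.
have cJ : {within `[a, b], continuous J}.
  apply: continuous_in_subspaceT => x; rewrite inE /= => /abr/r1r[_ /HI xe _].
  apply: cvgD; first by apply: cvgM; [exact: cvi|exact: cpsi2].
  apply: cvgM; first exact: (cfv x xe).
  exact: (continuous_is_derive dpsi).
have intc (g : R -> R) : {within `[a, b], continuous g} ->
    lebesgue_measure.-integrable `[a, b] (EFin \o g).
  by apply: continuous_compact_integrable; exact: segment_compact.
have cthw : {within `[a, b], continuous th} by exact: continuous_subspaceT.
apply: (@lt_le_trans _ _ (\int[lebesgue_measure]_(x in `[a, b]) th x)); last first.
  by apply: le_Rintegral => //; exact: intc.
have -> : \int[lebesgue_measure]_(x in `[a, b]) th x = Th b - Th a.
  have cTh := continuous_is_derive dTh.
  rewrite /Rintegral (@continuous_FTC2 _ _ Th) //.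
    split; first by move=> x _; have [] := dTh x.
    - exact/cvg_at_right_filter/cTh.
    - exact/cvg_at_left_filter/cTh.
  by move=> x _; exact: is_derive_derive1.
have [A1 A2 _ A3] := zl a (lexx a); have [B1 B2 _ B3] := zr b (lexx b).
rewrite /Th A1 A2 A3 B1 B2 B3 !mulr0 subr0 !addr0.
have -> : diff2 s (pospow 2) (a - x0) = 0.
  by rewrite /diff2 !pospow_le0 ?mulr0 ?subr0 ?addr0 ///a; lra.
have -> : diff2 s (pospow 2) (b - x0) = 2 * s ^+ 2.
  by rewrite diff2_right// ?/b; [ring|lra].
have -> : - 2 * w * (s ^+ 2)^-1 / 2 * (2 * s ^+ 2) = - 2 * w by field; rewrite gt_eqF.
by rewrite mulr0 subr0 /w; have := mulr_gt0 eta0 (exprn_gt0 2 h0); lra.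
Qed.

End WeakTouching.

(** * The maximum principle on the graph *)

Section FamilyMax.
Variable R : realType.

Lemma family_max (K : finType) (k0 : K) (r : K -> R) (z : K -> R -> R -> R)
    (T t1 : R) : T <= t1 -> (forall k, 0 <= r k) ->
  (forall k, {within [set p : R * R | p.1 \in `[T, t1] /\ p.2 \in `[0, r k]],
     continuous (fun p => z k p.1 p.2)}) ->
  exists k t x, [/\ T <= t <= t1, 0 <= x <= r k &
    forall k' t' x', T <= t' <= t1 -> 0 <= x' <= r k' -> z k' t' x' <= z k t x].
Proof.
move=> Tt r0 cz.
have maxk k : exists m : R * R, (T <= m.1 <= t1 /\ 0 <= m.2 <= r k) /\
    forall t x, T <= t <= t1 -> 0 <= x <= r k -> z k t x <= z k m.1 m.2.
  set A := [set p : R * R | p.1 \in `[T, t1] /\ p.2 \in `[0, r k]].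
  have A0 : A !=set0 by exists (T, 0); rewrite /A /= !in_itv /= !lexx Tt r0.
  have cA : compact A.
    have -> : A = `[T, t1]%classic `*` `[0, r k]%classic by [].
    by apply: compact_setX; exact: segment_compact.
  have [m /set_mem mA mmax] := compact_EVT_max A0 cA (cz k).
  exists m; split; first by move: mA; rewrite /A /= !in_itv.
  move=> t x tT xr; apply: (mmax (t, x)); apply: mem_set.
  by rewrite /A /= !in_itv /= tT xr.
have [m mP] := choice maxk.
case: (@Order.TotalTheory.arg_maxP _ _ _ k0 xpredT (fun k => z k (m k).1 (m k).2)) => // k _ kmax.
exists k, (m k).1, (m k).2; have [[m1 m2] _] := mP k; split=> // k' t' x' tT xr.
have [_ H] := mP k'; exact: le_trans (H _ _ tT xr) (kmax k' isT).
Qed.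

End FamilyMax.

Section Ends.
Variables (R : realType) (Om : star_graph R).
Implicit Type v : gfun Om.

(** An end of an edge, so that the Kirchhoff condition becomes one sum:
    [inl e] is the end at coordinate 0, [inr e] the one at [clen e].
    A loop contributes both of its ends to its vertex. *)
Definition eend : finType := (edge Om + cedge Om)%type.

Definition end_edge (k : eend) : edge Om :=
  match k with inl e => e | inr e => inl e end.

Definition end_vert (k : eend) : vert Om :=
  match k with inl e => src e | inr e => ctgt e end.

Definition end_fun v (k : eend) (x : R) : R :=
  match k with inl e => v e x | inr e => v (inl e) (clen e - x) end.

Lemma flux_ends v (V : vert Om) (p : eend -> R) :
  (forall k, rderiv (end_fun v k) (p k)) ->
  flux v V = \sum_(k : eend | end_vert k == V) thick (end_edge k) * p k.
Proof.
move=> vp; rewrite /flux [RHS]big_sumType; congr (_ + _); apply: eq_bigr => e _ /=;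
  congr (_ * _); rewrite /dir_deriv.
  apply: (cvg_lim (@norm_hausdorff _ _)).
  rewrite (_ : (fun h => _) = (fun h => (end_fun v (inl e) h - end_fun v (inl e) 0) / h)).
    exact: (vp (inl e)).
  by apply/funext => h; rewrite add0r mul1r.
apply: (cvg_lim (@norm_hausdorff _ _)).
rewrite (_ : (fun h => _) = (fun h => (end_fun v (inr e) h - end_fun v (inr e) 0) / h)).
  exact: (vp (inr e)).
by apply/funext => h; rewrite /end_fun subr0 mulN1r.
Qed.

(** A length scale for the barrier; an outer path has no length of its own. *)
Definition edge_unit (e : edge Om) : R :=
  match e with inl e => clen e | inr _ => 1 end.

Lemma edge_unit_gt0 e : 0 < edge_unit e.
Proof. by case: e => [e|j] /=; [exact: clen_gt0|exact: ltr01]. Qed.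

(** A positive function which decreases into every edge from each of its
    vertices and grows to infinity along the outer paths. *)
Definition barrier : gfun Om := fun e x =>
  2 - x / edge_unit e + (x / edge_unit e) ^+ 2.

Lemma barrier_ge1 e x : 1 <= barrier e x.
Proof. by rewrite /barrier; set y := x / _; nra. Qed.

Lemma barrier_outer_ge j x : x <= barrier (inr j) x.
Proof. by rewrite /barrier /= divr1; nra. Qed.

(** The barrier is symmetric on the center edges, so that one slope serves both
    ends. *)
Lemma end_fun_barrier k x :
  end_fun barrier k x = barrier (end_edge k) x.
Proof.
case: k => [e|e] //=; rewrite /barrier /=.
by field; rewrite gt_eqF// clen_gt0.
Qed.

Lemma barrier_expand e x y : let l := edge_unit e in
  barrier e y = barrier e x + (- l^-1 + 2 * x / l ^+ 2) * (y - x) +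
     (2 / l ^+ 2) / 2 * (y - x) ^+ 2.
Proof. by move=> l; rewrite /barrier -/l; field; rewrite gt_eqF// edge_unit_gt0. Qed.

Lemma rderiv_barrier k : rderiv (end_fun barrier k) (- (edge_unit (end_edge k))^-1).
Proof.
set e := end_edge k.
have -> : end_fun barrier k = (fun y => barrier e 0 + (- (edge_unit e)^-1) * (y - 0) +
     (2 / edge_unit e ^+ 2) / 2 * (y - 0) ^+ 2).
  apply/funext => y; rewrite end_fun_barrier (barrier_expand e 0 y) mulr0 mul0r addr0//.
have := is_derive_rderiv (is_derive_parabola (barrier e 0) (- (edge_unit e)^-1)
  (2 / edge_unit e ^+ 2) 0 0).
rewrite subr0 mulr0 addr0.
by under eq_fun do rewrite add0r.
Qed.

Lemma continuous_barrier e : continuous (barrier e).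
Proof.
rewrite (_ : barrier e = fun y => barrier e 0 +
   (- (edge_unit e)^-1 + 2 * 0 / edge_unit e ^+ 2) * (y - 0) +
     (2 / edge_unit e ^+ 2) / 2 * (y - 0) ^+ 2).
  exact: continuous_is_derive (fun x => is_derive_parabola _ _ _ _ _).
by apply/funext => y; exact: barrier_expand.
Qed.

Lemma end_fun_vertex v k l : vertex_compatible v -> end_vert k = end_vert l ->
  end_fun v k 0 = end_fun v l 0.
Proof.
by move=> [val [Hs Ht]]; case: k => [e|e]; case: l => [e'|e'] /= E;
  rewrite ?subr0 ?Hs ?Ht E.
Qed.

Lemma edge_point (e : edge Om) x : x \in edge_dom e ->
  x \in edge_int e \/ exists k, forall v, v e x = end_fun v k 0.
Proof.
case: e => [e|j] /=; rewrite !in_itv /= ?andbT.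
  move=> /andP[]; rewrite le_eqVlt => /orP[/eqP<-|x0]; first by right; exists (inl (inl e)).
  rewrite le_eqVlt => /orP[/eqP->|xL]; last by left; rewrite x0.
  by right; exists (inr e) => v /=; rewrite subr0.
rewrite le_eqVlt => /orP[/eqP<-|x0]; last by left.
by right; exists (inl (inr j)).
Qed.

End Ends.

Section MaximumPrinciple.
Variables (R : realType) (Om : star_graph R).

(** Phragmen-Lindelof form of the maximum principle.  If [w] exceeded the
    bound, then so would the maximum of
    [expR (- K (t - T)) * w - M - eps * expR (lam * (t - T)) * barrier], which
    exists because the barrier is large far out on the outer paths.  The slopes
    of the barrier exclude a maximum at a vertex, its growth in time excludes
    one inside an edge. The time derivative of [w] is only compared with
    parabolas touching [w] from above, so that no second derivative of [w] is
    required. *)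
Lemma graph_maximum_principle (w : R -> gfun Om) (T t1 K M : R) :
  0 <= M ->
  (forall e, {within [set p : R * R | p.2 \in edge_dom e],
     continuous (fun p => w p.1 e p.2)}) ->
  (forall t, vertex_compatible (w t)) ->
  (forall t e x, x \in edge_dom e -> w t e x <= 1) ->
  (forall t, exists p : eend Om -> R, (forall k, rderiv (end_fun (w t) k) (p k)) /\
     forall V, 0 <= \sum_(k : eend Om | end_vert k == V) thick (end_edge k) * p k) ->
  (forall t e x (b d r : R), T < t <= t1 -> x \in edge_int e -> 0 < r ->
     0 < w t e x ->
     (forall y, `|y - x| < r ->
        w t e y <= w t e x + b * (y - x) + d / 2 * (y - x) ^+ 2) ->
     exists2 l, is_derive t 1 (fun s => w s e x) l & l <= d + K * w t e x) ->
  (forall e x, x \in edge_dom e -> w T e x <= M) ->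
  forall t e x, T <= t <= t1 -> x \in edge_dom e ->
    w t e x <= M * expR (K * (t - T)).
Proof.
move=> M0 cw vw w1 kw intw initw ts es xs tsT xse.
(* [lam] beats the ratio of the second derivative of the barrier to the barrier *)
pose lam := 1 + \sum_(e : edge Om) 2 / edge_unit e ^+ 2.
have l2 (e : edge Om) : 0 <= 2 / edge_unit e ^+ 2.
  by rewrite divr_ge0// exprn_ge0// ltW// edge_unit_gt0.
have lamP (e : edge Om) : 2 / edge_unit e ^+ 2 < lam.
  rewrite /lam (bigD1 e)//= addrCA ltrDl ltr_wpDr// sumr_ge0//.
have lam0 : 0 < lam by rewrite ltr_wpDr// sumr_ge0.
have scl (A B : R) : (forall eps, 0 < eps -> A <= B + eps * expR (K * (ts - T)) *
     (expR (lam * (ts - T)) * barrier es xs)) -> A <= B.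
  move=> H; rewrite leNgt; apply/negP => BA.
  set C := expR (K * (ts - T)) * (expR (lam * (ts - T)) * barrier es xs).
  have C0 : 0 < C.
    by rewrite !mulr_gt0 ?expR_gt0// (lt_le_trans ltr01)// barrier_ge1.
  have := H ((A - B) / 2 / C); rewrite !divr_gt0 ?subr_gt0// => /(_ isT).
  rewrite -mulrA -/C divfK ?gt_eqF//; lra.
apply: scl => eps eps0.
pose z (e : edge Om) (t x : R) := expR (- K * (t - T)) * w t e x - M -
   eps * expR (lam * (t - T)) * barrier e x.
have zw e t x : w t e x = expR (K * (t - T)) * (z e t x + M +
    eps * expR (lam * (t - T)) * barrier e x).
  have -> : z e t x + M + eps * expR (lam * (t - T)) * barrier e x =
      expR (- K * (t - T)) * w t e x by rewrite /z; ring.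
  by rewrite mulrA -expRD mulNr subrr expR0 mul1r.
suff zs : z es ts xs <= 0.
  rewrite (zw es) mulrDr mulrDr [X in X <= _](_ : _ =
    expR (K * (ts - T)) * z es ts xs + (M * expR (K * (ts - T)) +
    eps * expR (K * (ts - T)) * (expR (lam * (ts - T)) * barrier es xs))); last by ring.
  by rewrite gerDr pmulr_rle0// expR_gt0.
rewrite leNgt; apply/negP => zs0.
pose E := expR (`|K| * (t1 - T)).
pose X := Num.max (E / eps) xs + 1.
have X0 : 0 < X.
  by rewrite /X ltr_wpDl// le_max divr_ge0// ?expR_ge0// ltW.
pose r (e : edge Om) := match e with inl e => clen e | inr _ => X end.
have rdom e x : 0 <= x <= r e -> x \in edge_dom e.
  by case: e => [e|j] /= /andP[x0 xr]; rewrite in_itv /= x0 ?xr.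
have xsr : 0 <= xs <= r es.
  case: (es) xse => [e|j] /=; rewrite in_itv //= andbT => -> /=.
  by rewrite /X ler_wpDr// le_max lexx orbT.
have zfar j t x : T <= t <= t1 -> X <= x -> z (inr j) t x <= 0.
  move=> /andP[Tt tt1] Xx.
  have x0 : 0 <= x by rewrite (le_trans _ Xx)// ltW.
  have wE : expR (- K * (t - T)) * w t (inr j) x <= E.
    apply: (@le_trans _ _ (expR (- K * (t - T)))).
      by rewrite ler_piMr ?expR_ge0// w1//= in_itv /= x0.
    rewrite /E ler_expR (@le_trans _ _ (`|K| * (t - T)))//.
      by rewrite ler_wpM2r ?subr_ge0// -normrN ler_norm.
    by rewrite ler_wpM2l// lerB.
  have : E <= eps * expR (lam * (t - T)) * barrier (inr j) x.
    have Eb : E <= eps * barrier (inr j) x.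
      rewrite mulrC -ler_pdivrMr// (le_trans _ (barrier_outer_ge _ _))//.
      by rewrite (le_trans _ Xx)// /X ler_wpDr// le_max lexx.
    apply: (le_trans Eb); rewrite mulrAC ler_peMr//.
      by rewrite mulr_ge0 ?(ltW eps0)// (le_trans ler01)// barrier_ge1.
    by rewrite -expR0 ler_expR mulr_ge0 ?(ltW lam0)// subr_ge0.
  by rewrite /z; lra.
have cz e : {within [set p : R * R | p.1 \in `[T, t1] /\ p.2 \in `[0, r e]],
    continuous (fun p => z e p.1 p.2)}.
  have cwe : {within [set p : R * R | p.1 \in `[T, t1] /\ p.2 \in `[0, r e]],
      continuous (fun p => w p.1 e p.2)}.
    by apply: continuous_subspaceW (cw e) => p /= [_]; rewrite in_itv; exact: rdom.
  have cE c : continuous (fun p : R * R => expR (c * (p.1 - T))).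
    exact: (continuous_fst_comp (continuous_is_derive (is_derive_expR_scaled c T))).
  have ch : continuous (fun p : R * R => eps * expR (lam * (p.1 - T)) * barrier e p.2).
    move=> p; apply: cvgM; last exact: (continuous_snd_comp (@continuous_barrier _ _ e)).
    by apply: cvgM; [exact: cvg_cst|exact: cE].
  move=> p; apply: cvgB; last exact: (continuous_subspaceT ch).
  apply: cvgB; last exact: cvg_cst.
  by apply: cvgM; [exact: (continuous_subspaceT (cE (- K)))|exact: cwe].
have Tt1 : T <= t1 by case/andP: tsT => /le_trans; apply.
have r0 e : 0 <= r e by case: e => [e|j] /=; rewrite ltW// clen_gt0.
have [e0 [t0 [x0 [t0T x0r zmax]]]] := family_max es Tt1 r0 cz.
have zpos : 0 < z e0 t0 x0 by exact: lt_le_trans zs0 (zmax _ _ _ tsT xsr).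
have e0dom := rdom _ _ x0r.
have x0X j : e0 = inr j -> x0 < X.
  move=> ej; rewrite ltNge; apply/negP => Xx0.
  by have := zfar j t0 x0 t0T Xx0; rewrite -ej leNgt zpos.
have bpos (e : edge Om) x t : 0 < eps * expR (lam * (t - T)) * barrier e x.
  by rewrite !mulr_gt0 ?expR_gt0// (lt_le_trans ltr01)// barrier_ge1.
have Tt0 : T < t0.
  rewrite lt_neqAle; case/andP: (t0T) => -> _; rewrite andbT.
  apply/eqP => Et0; move: zpos; rewrite /z -Et0 subrr mulr0 expR0 mul1r.
  have := initw _ _ e0dom; have := bpos e0 x0 T; rewrite subrr mulr0; lra.
have wpos : 0 < w t0 e0 x0.
  rewrite zw mulr_gt0 ?expR_gt0//; have := bpos e0 x0 t0; lra.
have [x0int|[k0 Ek0]] := edge_point e0dom; last first.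
  (* all slopes of [z] into the edges at this vertex are nonpositive, whereas the
     Kirchhoff inequality and the barrier make their weighted sum positive *)
  have [p [dp sp]] := kw t0.
  pose c := eps * expR (lam * (t0 - T)).
  have c0 : 0 < c by rewrite mulr_gt0// expR_gt0.
  pose zt : gfun Om := fun e x => z e t0 x.
  have ztE k x : end_fun zt k x = expR (- K * (t0 - T)) * end_fun (w t0) k x +
       (- M + (- c) * end_fun (@barrier _ Om) k x).
    by case: k => e /=; rewrite /zt /z /c; ring.
  have dz k : rderiv (end_fun zt k) (expR (- K * (t0 - T)) * p k +
       c / edge_unit (end_edge k)).
    have d0 : rderiv (fun _ : R => - M) 0.
      by have := is_derive_rderiv (is_derive_cst (- M) (0 : R) 1).
    have := rderivD (rderivZ (a := expR (- K * (t0 - T))) (dp k))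
       (rderivD d0 (rderivZ (a := - c) (@rderiv_barrier _ Om k))).
    move=> H; apply: (rderiv_eq H); first by rewrite add0r mulrNN.
    by move=> x; rewrite ztE.
  have vz k : end_vert k = end_vert k0 -> end_fun zt k 0 = z e0 t0 x0.
    move=> kk0; have := Ek0 zt; rewrite {1}/zt => ->.
    rewrite !ztE (end_fun_vertex (vw t0) kk0).
    by rewrite !end_fun_barrier /barrier !mul0r.
  have dz0 k : end_vert k = end_vert k0 ->
      expR (- K * (t0 - T)) * p k + c / edge_unit (end_edge k) <= 0.
    move=> kk0; apply: (@rderiv_le0 _ _ _ (r (end_edge k))) (dz k).
      by case: (end_edge k) => [e|j] /=; rewrite ?clen_gt0.
    move=> h /andP[h0 hr]; rewrite (vz k kk0).
    case: k {kk0 dz vz} hr => [e|e] /= hr; rewrite /zt; apply: zmax => //.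
      by rewrite !ltW.
    by have hr1 : h < clen e := hr; have : 0 <= clen e - h <= clen e by apply/andP; split; lra.
  have : \sum_(k : eend Om | end_vert k == end_vert k0) thick (end_edge k) *
      (expR (- K * (t0 - T)) * p k + c / edge_unit (end_edge k)) <= 0.
    apply: sumr_le0 => k /eqP kk0; rewrite mulr_ge0_le0//; last exact: dz0.
    exact/ltW/thick_gt0.
  apply/negP; rewrite -ltNge.
  under eq_bigr do rewrite mulrDr mulrCA.
  rewrite big_split /= -mulr_sumr ltr_wpDl//.
    by rewrite mulr_ge0 ?expR_ge0.
  have tc k : 0 < thick (end_edge k) * (c / edge_unit (end_edge k)) :> R.
    by rewrite mulr_gt0 ?thick_gt0// divr_gt0// edge_unit_gt0.
  rewrite (bigD1 k0)//= ltr_wpDr ?tc// sumr_ge0// => k _; exact/ltW/tc.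
(* a multiple of the barrier plus a constant is a parabola touching [w] from above
   at [x0], and it grows in time faster than its curvature allows *)
have [rI rI0 HI] := edge_int_open x0int.
pose c := expR (K * (t0 - T)) * (eps * expR (lam * (t0 - T))).
pose l := edge_unit e0.
have c0 : 0 < c by rewrite !mulr_gt0 ?expR_gt0.
pose rX := if e0 is inr _ then X - x0 else 1.
have rX0 : 0 < rX by rewrite /rX; case: (e0) x0X => // j /(_ j erefl); rewrite subr_gt0.
have touch y : `|y - x0| < Num.min rI rX ->
    w t0 e0 y <= w t0 e0 x0 + c * (- l^-1 + 2 * x0 / l ^+ 2) * (y - x0) +
      c * (2 / l ^+ 2) / 2 * (y - x0) ^+ 2.
  rewrite lt_min => /andP[/HI/edge_int_dom ye yX].
  have yr : 0 <= y <= r e0.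
    move: ye yX; rewrite /rX; case: (e0) => [e|j] /=; rewrite in_itv //= andbT => ->.
    by move=> /(le_lt_trans (ler_norm _)) /=; lra.
  rewrite (zw _ _ y) (zw _ _ x0) (barrier_expand e0 x0 y) -/l /c.
  have := zmax e0 t0 y t0T yr.
  rewrite -(ler_pM2l (expR_gt0 (K * (t0 - T)))); lra.
have [||l1 dw lle] := intw t0 e0 x0 _ _ (Num.min rI rX) _ x0int _ wpos touch.
- by rewrite Tt0; case/andP: t0T.
- by rewrite lt_min rI0.
have dzt : is_derive t0 1 (fun s => z e0 s x0)
   (((- K * expR (- K * (t0 - T))) * w t0 e0 x0 + expR (- K * (t0 - T)) * l1) - 0
     - eps * barrier e0 x0 * (lam * expR (lam * (t0 - T)))).
  have d1 := is_derive_mulf (is_derive_expR_scaled (- K) T t0) dw.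
  have d2 := is_derive_scalef (eps * barrier e0 x0) (is_derive_expR_scaled lam T t0).
  rewrite (_ : (fun s => z e0 s x0) = (fun s => expR (- K * (s - T)) * w s e0 x0 - M
      - eps * barrier e0 x0 * expR (lam * (s - T)))).
    exact: is_derive_subf (is_derive_subf d1 (is_derive_cst M t0 1)) d2.
  by apply/funext => s; rewrite /z; ring.
have /(is_derive_ge0_left_max Tt0 dzt) : forall s, T <= s <= t0 -> z e0 s x0 <= z e0 t0 x0.
  move=> s /andP[Ts st0]; apply: zmax => //; rewrite Ts /=.
  by case/andP: t0T => _; exact: le_trans.
apply/negP; rewrite -ltNge subr0.
have E1 : expR (- K * (t0 - T)) * c = eps * expR (lam * (t0 - T)).
  by rewrite /c mulrA -expRD mulNr addNr expR0 mul1r.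
have lle' : expR (- K * (t0 - T)) * l1 <= eps * expR (lam * (t0 - T)) * (2 / l ^+ 2)
    + K * (expR (- K * (t0 - T)) * w t0 e0 x0).
  rewrite -E1; have := ler_wpM2l (expR_ge0 (- K * (t0 - T))) lle; lra.
have e2 : eps * expR (lam * (t0 - T)) * (2 / l ^+ 2) <
    eps * expR (lam * (t0 - T)) * lam.
  by rewrite ltr_pM2l ?lamP// mulr_gt0// expR_gt0.
have e3 : eps * expR (lam * (t0 - T)) * lam <=
    eps * expR (lam * (t0 - T)) * lam * barrier e0 x0.
  by rewrite ler_peMr ?barrier_ge1// !mulr_ge0 ?expR_ge0// ltW.
lra.
Qed.

End MaximumPrinciple.

(** * Differences of solutions and supersolutions *)

Section EndDerivatives.
Variables (R : realType) (Om : star_graph R).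
Implicit Types (g : R -> R) (v : gfun Om).

Lemma C1_on_eps (I : interval R) g x : C1_on I g -> x \in I ->
  exists l : R, forall eps : R, 0 < eps -> exists2 d : R, 0 < d &
    forall y, `|y - x| < d -> y \in I -> y != x ->
      `|(g y - g x) / (y - x) - l| < eps.
Proof.
move=> [dg [_ H]] /H /cvgrPdist_lt {}H; exists (dg x) => eps e0.
have [d /= d0 Hd] := H eps e0; exists d => // y yd yI yx.
by rewrite distrC; apply: Hd => //=; rewrite distrC.
Qed.

Lemma C1_on_rderiv (I : interval R) g x (r : R) : C1_on I g -> 0 < r ->
  (forall h, 0 <= h < r -> x + h \in I) -> exists l, rderiv (fun h => g (x + h)) l.
Proof.
move=> gC1 r0 xI; have x_I : x \in I by rewrite -[x]addr0 xI// lexx.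
have [l H] := C1_on_eps gC1 x_I; exists l; apply/rderivP => eps e0.
have [d d0 {}H] := H eps e0; exists (Num.min d r); first by rewrite lt_min d0.
move=> h; rewrite lt_min => /and3P[h0 hd hr].
have E : x + h - x = h by rewrite addrAC subrr add0r.
have := H (x + h); rewrite E addr0 gtr0_norm// => /(_ hd).
by apply; [rewrite xI// ltW|rewrite gt_eqF// ltrDl].
Qed.

Lemma C1_on_rderivN (I : interval R) g x (r : R) : C1_on I g -> 0 < r ->
  (forall h, 0 <= h < r -> x - h \in I) -> exists l, rderiv (fun h => g (x - h)) l.
Proof.
move=> gC1 r0 xI; have x_I : x \in I by rewrite -[x]subr0 xI// lexx.
have [l H] := C1_on_eps gC1 x_I; exists (- l); apply/rderivP => eps e0.
have [d d0 {}H] := H eps e0; exists (Num.min d r); first by rewrite lt_min d0.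
move=> h; rewrite lt_min => /and3P[h0 hd hr].
have E : x - h - x = - h by rewrite addrAC subrr add0r.
have := H (x - h); rewrite E subr0 normrN gtr0_norm// => /(_ hd).
rewrite xI ?ltW// lt_eqF ?gtrBl// => /(_ isT isT).
by rewrite invrN mulrN -opprD normrN opprK.
Qed.

Lemma C1_ends_rderiv v : (forall e, C1_on (edge_dom e) (v e)) ->
  exists p : eend Om -> R, forall k, rderiv (end_fun v k) (p k).
Proof.
move=> vC1; suff /choice[p] : forall k, exists l, rderiv (end_fun v k) l by exists p.
move=> k.
pose r := edge_unit (end_edge k); have r0 : 0 < r by exact: edge_unit_gt0.
case: k @r r0 => [[e|j]|e] /= r0.
- have [|l H] := C1_on_rderiv (x := 0) (vC1 (inl e)) r0.
    by move=> h /andP[h0 hr]; rewrite add0r in_itv /= h0 ltW.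
  by exists l; apply: (rderiv_eq H) => // x; rewrite add0r.
- have [|l H] := C1_on_rderiv (x := 0) (vC1 (inr j)) r0.
    by move=> h /andP[h0 hr]; rewrite add0r in_itv /= h0.
  by exists l; apply: (rderiv_eq H) => // x; rewrite add0r.
- have [|l H] := C1_on_rderivN (x := clen e) (vC1 (inl e)) r0.
    by move=> h /andP[h0 hr]; rewrite in_itv /=; apply/andP; split; lra.
  by exists l.
Qed.

(** Break points may accumulate at infinity but not at a vertex; hence a
    piecewise C^1 function has one-sided derivatives there. *)
Lemma locally_finite_gap (B : set R) (x : R) :
  (forall M : R, finite_set (B `&` [set` `[- M, M]])) ->
  exists2 d : R, 0 < d & forall y, `|y - x| < d -> y != x -> ~ B y.
Proof.
move=> /(_ (`|x| + 1)) finB.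
pose A := (B `&` [set` `[- (`|x| + 1), `|x| + 1]]) `\ x.
have : finite_set A by apply: sub_finite_set finB => y [].
have acc : accessible_space R by apply: hausdorff_accessible; exact: norm_hausdorff.
move=> /(accessible_finite_set_closed.1 acc)/closed_openC oA.
have : nbhs x (~` A) by apply: open_nbhs_nbhs; split=> // -[_]; apply.
move=> [d /= d0 H]; exists (Num.min d 1); first by rewrite lt_min d0 /=.
move=> y; rewrite lt_min => /andP[yd y1] yx By.
apply: (H y) => /=; first by rewrite distrC.
split; last exact/eqP.
split=> //=; rewrite in_itv /= -ler_norml.
by have := ler_distD x y 0; rewrite !subr0; lra.
Qed.

Lemma piecewise_C1_ends_rderiv v : (forall e, piecewise_C1 (edge_dom e) (v e)) ->
  exists p : eend Om -> R, forall k, rderiv (end_fun v k) (p k).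
Proof.
move=> vC1; suff /choice[p] : forall k, exists l, rderiv (end_fun v k) l by exists p.
move=> k.
pose u := edge_unit (end_edge k); have u0 : 0 < u by exact: edge_unit_gt0.
pose x0 := if k is inr e then clen e else 0.
have [B [finB HB]] := vC1 (end_edge k).
have [d d0 Hd] := locally_finite_gap x0 finB.
pose r := Num.min d u / 2.
have m0 : 0 < Num.min d u by rewrite lt_min d0.
have r0 : 0 < r by rewrite divr_gt0.
have rd : r < d.
  apply: (@lt_le_trans _ _ (Num.min d u)); first by rewrite /r; lra.
  by rewrite ge_min lexx.
have ru : r < u.
  apply: (@lt_le_trans _ _ (Num.min d u)); first by rewrite /r; lra.
  by rewrite ge_min lexx orbT.
case: k @x0 @u {u0 m0} HB Hd @r r0 rd ru => [[e|j]|e] /= HB Hd r0 rd ru.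
- set r := Num.min _ _ / 2 in r0 rd ru.
  have C : C1_on `[0, r] (v (inl e)).
    apply: HB => //.
    + by rewrite in_itv /= lexx ltW// clen_gt0.
    + by rewrite in_itv /= (ltW r0) ltW.
    move=> x /andP[x0 xr]; apply: Hd; last by rewrite gt_eqF.
    by rewrite subr0 gtr0_norm// (lt_trans xr).
  have [|l H] := C1_on_rderiv (x := 0) C r0.
    by move=> h /andP[h0 hr]; rewrite add0r in_itv /= h0 ltW.
  by exists l; apply: (rderiv_eq H) => // x; rewrite add0r.
- set r := Num.min _ _ / 2 in r0 rd ru.
  have C : C1_on `[0, r] (v (inr j)).
    apply: HB => //.
    + by rewrite in_itv /= lexx.
    + by rewrite in_itv /= (ltW r0).
    move=> x /andP[x0 xr]; apply: Hd; last by rewrite gt_eqF.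
    by rewrite subr0 gtr0_norm// (lt_trans xr).
  have [|l H] := C1_on_rderiv (x := 0) C r0.
    by move=> h /andP[h0 hr]; rewrite add0r in_itv /= h0 ltW.
  by exists l; apply: (rderiv_eq H) => // x; rewrite add0r.
- set r := Num.min _ _ / 2 in r0 rd ru.
  have C : C1_on `[clen e - r, clen e] (v (inl e)).
    apply: HB => //; rewrite ?in_itv /=; first by lra.
    + by apply/andP; split; lra.
    + by rewrite lexx andbT ltW// clen_gt0.
    move=> x /andP[x0 xr]; apply: Hd; last by rewrite lt_eqF.
    by rewrite ltr0_norm ?subr_lt0//; lra.
  have [|l H] := C1_on_rderivN (x := clen e) C r0.
    by move=> h /andP[h0 hr]; rewrite in_itv /=; apply/andP; split; lra.
  by exists l.
Qed.

End EndDerivatives.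

Section Solutions.
Variables (R : realType) (Om : star_graph R) (f : R -> R).

Lemma solution_interior (u : R -> gfun Om) (t : R) (e : edge Om) (x : R) : entire_solution f u ->
  x \in edge_int e ->
  [/\ is_derive t 1 (fun s => u s e x) (derive1n 2 (u t e) x + f (u t e x)),
      forall y, y \in edge_int e -> is_derive y 1 (u t e) (derive1 (u t e) y) &
      is_derive x 1 (derive1 (u t e)) (derive1n 2 (u t e) x)].
Proof.
move=> us xe; have [d [[_ d2] E]] := sol_equation us t xe.
split; first by rewrite -E; exact: derivable_is_derive1.
- by move=> y /(sol_equation us t)[_ [[+ _] _]]; exact: derivable_is_derive1.
- exact: derivable_is_derive1.
Qed.

(** The parabola may touch [g - k] at a point where the second derivatives are
    not continuous, as [second_order_max] permits. *)
Lemma touching_second_order (e : edge Om) (g k g1 k1 : R -> R) (x b d r g2 k2 : R) :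
  x \in edge_int e -> 0 < r ->
  (forall y, y \in edge_int e -> is_derive y 1 g (g1 y)) -> is_derive x 1 g1 g2 ->
  (forall y, y \in edge_int e -> is_derive y 1 k (k1 y)) -> is_derive x 1 k1 k2 ->
  (forall y, `|y - x| < r ->
     g y - k y <= g x - k x + b * (y - x) + d / 2 * (y - x) ^+ 2) ->
  g2 <= k2 + d.
Proof.
move=> xe r0 dg dg1 dk dk1 H.
have [rI rI0 HI] := edge_int_open xe.
suff : g2 - k2 - d <= 0 by lra.
have m0 : 0 < Num.min r rI by rewrite lt_min r0.
apply: (@second_order_max _ (fun y => g y - k y - (0 + b * (y - x) + d / 2 * (y - x) ^+ 2))
  (fun y => g1 y - k1 y - (b + d * (y - x))) x _ _ m0).
- move=> y; rewrite lt_min => /andP[_ /HI ye].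
  by apply: is_derive_subf (is_derive_subf (dg y ye) (dk y ye)) (is_derive_parabola _ _ _ _ _).
- by apply: is_derive_subf (is_derive_subf dg1 dk1) (is_derive_affine _ _ _ _).
- move=> y; rewrite lt_min => /andP[/H yr _].
  by rewrite subrr expr0n /= !mulr0 !addr0 subr0; lra.
Qed.

(** A supersolution need not have a second derivative; what is left of its
    equation is this bound on touching parabolas.  For a weak supersolution,
    a parabola slightly flatter than the osculating one of [g] lies below [g],
    and carries over to a parabola touching [v] from below. *)
Lemma supersolution_touch (e : edge Om) (v : gfun Om) (g g1 : R -> R)
    (x b d r g2 : R) :
  continuous f -> supersolution f v -> x \in edge_int e -> 0 < r ->
  (forall y, y \in edge_int e -> is_derive y 1 g (g1 y)) -> is_derive x 1 g1 g2 ->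
  (forall y, `|y - x| < r ->
     g y - v e y <= g x - v e x + b * (y - x) + d / 2 * (y - x) ^+ 2) ->
  g2 <= d - f (v e x).
Proof.
move=> cf vs xe r0 dg dg1 H.
have [vc|vw] := super_equation vs e.
  have [[_ d2] le0] := vc x xe.
  have dv y : y \in edge_int e -> is_derive y 1 (v e) (derive1 (v e) y).
    by move=> /vc[[d1 _] _]; exact: derivable_is_derive1.
  have := touching_second_order xe r0 dg dg1 dv (derivable_is_derive1 d2) H.
  by move: le0; rewrite /derive1n /=; lra.
rewrite leNgt; apply/negP => gt.
have [rI rI0 HI] := edge_int_open xe.
pose del := g2 - d + f (v e x).
have del0 : 0 < del by rewrite /del; lra.
pose Q y := g x + g1 x * (y - x) + (g2 - del / 2) / 2 * (y - x) ^+ 2.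
have del2 : 0 < g2 - (g2 - del / 2) by lra.
have [||s s0 Hs] := @strict_local_min _ (fun y => g y - Q y)
   (fun y => g1 y - (g1 x + (g2 - del / 2) * (y - x))) x rI _ rI0 _ _
   (is_derive_subf dg1 (is_derive_affine _ _ _ _)) del2.
- by move=> y /HI ye; exact: is_derive_subf (dg y ye) (is_derive_parabola _ _ _ _ _).
- by rewrite subrr mulr0 addr0 subrr.
have m0 : 0 < Num.min r s by rewrite lt_min r0.
have Qx : Q x = g x by rewrite /Q subrr expr0n /= !mulr0 !addr0.
have := super_weak_touch (alpha := g1 x - b) (kappa := g2 - del / 2 - d) cf
  (super_continuous vs (e := e)) vw xe m0.
suff /[swap] /[apply] : forall y, `|y - x| < Num.min r s -> v e x + (g1 x - b) * (y - x) +
   (g2 - del / 2 - d) / 2 * (y - x) ^+ 2 <= v e y by rewrite /del; lra.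
move=> y; rewrite lt_min => /andP[/H yr ys].
have : Q y <= g y.
  have [->|yx] := eqVneq y x; first by rewrite Qx.
  by have := Hs y yx ys; rewrite Qx subrr subr_gt0 => /ltW.
by rewrite /Q; lra.
Qed.

(** What comparison needs of the difference [w] of a solution and a
    supersolution, [F] being the difference of the reaction terms.  Both a
    stationary supersolution, classical or weak, and a second solution provide
    it. *)
Record gap_inequality (w F : R -> gfun Om) : Prop := {
  gap_continuous : forall e, {within [set p : R * R | p.2 \in edge_dom e],
     continuous (fun p => w p.1 e p.2)};
  gap_vertex : forall t, vertex_compatible (w t);
  gap_kirchhoff : forall t, exists p : eend Om -> R,
     (forall k, rderiv (end_fun (w t) k) (p k)) /\
     forall V, 0 <= \sum_(k : eend Om | end_vert k == V) thick (end_edge k) * p k;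
  gap_touch : forall t e x (b d r : R), x \in edge_int e -> 0 < r ->
     (forall y, `|y - x| < r ->
        w t e y <= w t e x + b * (y - x) + d / 2 * (y - x) ^+ 2) ->
     exists2 l, is_derive t 1 (fun s => w s e x) l & l <= d + F t e x }.

Lemma vertex_compatibleB (u v : gfun Om) : vertex_compatible u ->
  vertex_compatible v -> vertex_compatible (fun e x => u e x - v e x).
Proof.
move=> [a [Ha Ha']] [b [Hb Hb']]; exists (fun V => a V - b V).
by split=> e; rewrite ?Ha ?Hb ?Ha' ?Hb'.
Qed.

Lemma flux_gap (u v : gfun Om) (p q : eend Om -> R) :
  (forall k, rderiv (end_fun u k) (p k)) -> (forall k, rderiv (end_fun v k) (q k)) ->
  (forall V, flux v V <= flux u V) ->
  exists pq : eend Om -> R,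
    (forall k, rderiv (end_fun (fun e x => u e x - v e x) k) (pq k)) /\
    forall V, 0 <= \sum_(k : eend Om | end_vert k == V) thick (end_edge k) * pq k.
Proof.
move=> up vq uv; exists (fun k => p k + -1 * q k); split.
  move=> k; apply: (rderiv_eq (rderivD (up k) (rderivZ (a := -1) (vq k)))) => // x.
  by case: k => e /=; rewrite mulN1r.
move=> V; have := uv V; rewrite (flux_ends _ up) (flux_ends _ vq) -subr_ge0.
by rewrite -sumrB; under eq_bigr do rewrite -mulrBr -mulN1r.
Qed.

Lemma gap_supersolution (u : R -> gfun Om) (v : gfun Om) : continuous f ->
  entire_solution f u -> supersolution f v ->
  gap_inequality (fun t e x => u t e x - v e x)
    (fun t e x => f (u t e x) - f (v e x)).
Proof.
move=> cf us vs; split.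
- move=> e p; apply: cvgB; first exact: (sol_continuous us).
  exact: (within_snd (super_continuous vs (e := e))).
- by move=> t; apply: vertex_compatibleB; [exact: (sol_vertex us)|exact: (super_vertex vs)].
- move=> t.
  have [p up] := C1_ends_rderiv (fun e => sol_C1 us e t).
  have [q vq] := piecewise_C1_ends_rderiv (super_piecewise vs).
  apply: flux_gap up vq _ => V.
  by rewrite (sol_kirchhoff us); exact: (super_kirchhoff vs).
- move=> t e x b d r xe r0 H; have [dt du du1] := solution_interior t us xe.
  exists (derive1n 2 (u t e) x + f (u t e x)).
    by apply: is_derive_eq (is_derive_subf dt (is_derive_cst (v e x) t 1)) _; rewrite subr0.
  have := supersolution_touch cf vs xe r0 du du1 H; lra.
Qed.

Lemma gap_solutions (u v : R -> gfun Om) :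
  entire_solution f u -> entire_solution f v ->
  gap_inequality (fun t e x => u t e x - v t e x)
    (fun t e x => f (u t e x) - f (v t e x)).
Proof.
move=> us vs; split.
- by move=> e p; apply: cvgB; [exact: (sol_continuous us)|exact: (sol_continuous vs)].
- by move=> t; apply: vertex_compatibleB; [exact: (sol_vertex us)|exact: (sol_vertex vs)].
- move=> t.
  have [p up] := C1_ends_rderiv (fun e => sol_C1 us e t).
  have [q vq] := C1_ends_rderiv (fun e => sol_C1 vs e t).
  by apply: flux_gap up vq _ => V; rewrite (sol_kirchhoff us) (sol_kirchhoff vs).
- move=> t e x b d r xe r0 H; have [dt du du1] := solution_interior t us xe.
  have [dt' dv dv1] := solution_interior t vs xe.
  exists (derive1n 2 (u t e) x + f (u t e x) - (derive1n 2 (v t e) x + f (v t e x))).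
    exact: is_derive_subf dt dt'.
  have := touching_second_order xe r0 du du1 dv dv1 H; lra.
Qed.

Lemma solution_shift (u : R -> gfun Om) (s : R) : entire_solution f u ->
  entire_solution f (fun t => u (t + s)).
Proof.
move=> us; split.
- move=> e; have /subspace_continuousP cu := sol_continuous us (e := e).
  apply/subspace_continuousP => p pe.
  have := cu (p.1 + s, p.2) pe; apply: cvg_trans => A /=.
  rewrite /nbhs /= => -[[A1 A2] /= [n1 n2] H].
  exists ((fun t => t + s) @^-1` A1, A2) => /=.
    split=> //; have cs : {for p.1, continuous (fun t => t + s)}.
      by apply: cvgD; [exact: cvg_id|exact: cvg_cst].
    exact: (cs _ n1).
  by move=> [t x] /= [At Ax] xe; exact: (H (t + s, x)).
- by move=> t; exact: (sol_vertex us).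
- move=> e t x xe; have [dt [dx E]] := sol_equation us (t + s) xe.
  have d : is_derive t 1 (fun r => u (r + s) e x) (derive1 (fun r => u r e x) (t + s)).
    rewrite -[s]opprK; apply: (@is_derive_shift _ (fun r => u r e x)).
    by rewrite opprK; exact: derivable_is_derive1.
  split; [by have [] := d|split=> //].
  by rewrite (is_derive_derive1 d).
- by move=> e t; exact: (sol_C1 us).
- by move=> t V; exact: (sol_kirchhoff us).
Qed.

End Solutions.

(** * Ordering the front-like solution *)

Section Bistable.
Variables (R : realType) (f : R -> R).

Lemma slope_le (p q C r s : R) : (forall x, derivable f x 1) ->
  (forall x, p <= x <= q -> derive1 f x <= C) -> p <= r -> r <= s -> s <= q ->
  f s - f r <= C * (s - r).
Proof.
move=> df H pr rs sq.
have [|c] := MVT_segment rs (fun x _ => derivable_is_derive1 (df x)).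
  by apply: derivable_within_continuous => x _; exact: df.
rewrite in_itv /= => /andP[rc cs] ->.
by rewrite ler_wpM2r ?subr_ge0// H// (le_trans pr rc) (le_trans cs sq).
Qed.

Lemma bistable_continuous a : bistable f a -> continuous f.
Proof. by move=> hf x; exact/differentiable_continuous/derivable1_diffP/(bi_derivable hf). Qed.

Lemma bistable_lipschitz a : bistable f a -> exists2 L : R, 0 < L &
  forall r s, 0 <= r <= 1 -> 0 <= s <= 1 -> `|f s - f r| <= L * `|s - r|.
Proof.
move=> hf; have df : forall x, derivable f x 1 by exact: (bi_derivable hf).
have c1 : continuous (derive1 f) by exact: (bi_C1 hf).
have cn : {within `[0, 1], continuous (fun x => `|derive1 f x|)}.
  apply: continuous_subspaceT => x; apply: continuous_comp; first exact: c1.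
  exact: norm_continuous.
have [c _ cmax] := EVT_max ler01 cn.
exists (`|derive1 f c| + 1); first by rewrite ltr_wpDl.
have le r s : 0 <= r -> r <= s -> s <= 1 -> `|f s - f r| <= (`|derive1 f c| + 1) * `|s - r|.
  move=> r0 rs s1.
  have [|d] := MVT_segment rs (fun x _ => derivable_is_derive1 (df x)).
    by apply: derivable_within_continuous => x _; exact: df.
  rewrite in_itv /= => /andP[rd ds] ->; rewrite normrM ler_wpM2r// ler_wpDr//.
  by apply: cmax; rewrite in_itv /= (le_trans r0 rd) (le_trans ds).
move=> r s /andP[r0 r1] /andP[s0 s1]; case: (leP r s) => rs; first exact: le.
by rewrite distrC [`|s - r|]distrC le// ltW.
Qed.

(** Since the derivative of [f] is negative at 0 and at 1, nonnegative
    differences of values both close to 0, or both close to 1, are damped. *)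
Lemma bistable_stable a : bistable f a -> exists eta beta : R,
  [/\ 0 < eta, 0 < beta, eta < 1 &
    forall r s, 0 <= r -> r <= s -> s <= 1 -> s <= eta \/ 1 - eta <= r ->
      f s - f r <= - beta * (s - r)].
Proof.
move=> hf.
have c1 : continuous (derive1 f) by exact: (bi_C1 hf).
have aux p : derive1 f p < 0 -> exists2 d : R, 0 < d &
    forall x, `|x - p| < d -> derive1 f x <= derive1 f p / 2.
  move=> fp; have fp2 : 0 < - derive1 f p / 2 by rewrite divr_gt0// oppr_gt0.
  have /cvgrPdist_lt/(_ _ fp2) [d /= d0 H] := c1 p.
  exists d => // x xd; have : `|p - x| < d by rewrite distrC.
  by move=> /H /=; rewrite ltr_norml => /andP[]; lra.
have [d0 d00 H0] := aux 0 (bi_df0 hf); have [d1 d10 H1] := aux 1 (bi_df1 hf).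
pose eta := Num.min (Num.min d0 d1 / 2) (1 / 2).
have m0 : 0 < Num.min d0 d1 by rewrite lt_min d00.
have eta0 : 0 < eta by rewrite lt_min !divr_gt0.
have etam : eta < Num.min d0 d1.
  by apply: (@le_lt_trans _ _ (Num.min d0 d1 / 2)); [rewrite ge_min lexx|lra].
have [ed0 ed1] : eta < d0 /\ eta < d1 by move: etam; rewrite lt_min => /andP[].
pose beta := Num.min (- derive1 f 0 / 2) (- derive1 f 1 / 2).
have [b0 b1] : beta <= - derive1 f 0 / 2 /\ beta <= - derive1 f 1 / 2.
  by rewrite /beta !ge_min !lexx orbT.
exists eta, beta; split=> //.
- by rewrite lt_min !divr_gt0 ?oppr_gt0//; [exact: (bi_df1 hf)|exact: (bi_df0 hf)].
- by rewrite gt_min; apply/orP; right; lra.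
move=> r s r0 rs s1 [se|er].
  apply: (slope_le (bi_derivable hf) _ r0 rs se) => x /andP[x0 xe].
  have : derive1 f x <= derive1 f 0 / 2.
    by apply: H0; rewrite subr0 ger0_norm//; lra.
  by lra.
apply: (slope_le (bi_derivable hf) _ er rs s1) => x /andP[x0 xe].
have : derive1 f x <= derive1 f 1 / 2.
  by apply: H1; rewrite ler0_norm ?subr_le0//; lra.
by lra.
Qed.

End Bistable.

Section FrontLike.
Variables (R : realType) (Om : star_graph R) (f : R -> R) (a : R).
Variables (phi : R -> R) (c : R) (i : 'I_(npaths Om)).
Hypothesis hf : bistable f a.
Hypothesis hphi : travelling_wave f a phi c.

(** A solution stays below a supersolution if, for very negative times, it can
    only exceed it where both lie in the same stable range of [f].  There the
    excess decays exponentially, and it has done so since time [-oo]. *)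
Lemma ordered_of_early_stability (u v : R -> gfun Om) (eta T1 : R) :
  gap_inequality (fun t e x => u t e x - v t e x)
     (fun t e x => f (u t e x) - f (v t e x)) ->
  (forall t, between01 (u t)) -> (forall t, between01 (v t)) ->
  (exists2 beta : R, 0 < beta &
    forall r s, 0 <= r -> r <= s -> s <= 1 -> s <= eta \/ 1 - eta <= r ->
      f s - f r <= - beta * (s - r)) ->
  (forall t e x, t <= T1 -> x \in edge_dom e -> v t e x < u t e x ->
     u t e x <= eta \/ 1 - eta <= v t e x) ->
  forall t e x, x \in edge_dom e -> u t e x <= v t e x.
Proof.
move=> gap u01 v01 [beta beta0 stab] early.
have w1 t e x : x \in edge_dom e -> u t e x - v t e x <= 1.
  by move=> xe; have := u01 t e x xe; have := v01 t e x xe; lra.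
have step (T t K M : R) : T <= t -> 0 <= M ->
    (forall s e x, T < s <= t -> x \in edge_dom e -> v s e x < u s e x ->
       f (u s e x) - f (v s e x) <= K * (u s e x - v s e x)) ->
    (forall e x, x \in edge_dom e -> u T e x - v T e x <= M) ->
    forall e x, x \in edge_dom e -> u t e x - v t e x <= M * expR (K * (t - T)).
  move=> Tt M0 HK init e x xe.
  apply: (graph_maximum_principle M0 (gap_continuous gap) (gap_vertex gap) w1
    (gap_kirchhoff gap) _ init _ xe (t1 := t)); last by rewrite Tt lexx.
  move=> s e' y b d r sT ye r0 wpos H.
  have [l dl lle] := gap_touch gap ye r0 H; exists l => //.
  apply: (le_trans lle); rewrite lerD2l HK//; first exact: edge_int_dom.
  by rewrite -subr_gt0.
have early_le t e x : t <= T1 -> x \in edge_dom e -> u t e x <= v t e x.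
  move=> tT1 xe; rewrite -subr_le0 leNgt; apply/negP => w0.
  set w := u t e x - v t e x in w0.
  (* so far back that the decay brings the excess, at most 1, below [w] *)
  pose T := t - (beta * w)^-1.
  have bw0 : 0 < (beta * w)^-1 by rewrite invr_gt0 mulr_gt0.
  have Tt : T <= t by rewrite /T; lra.
  have : w <= 1 * expR (- beta * (t - T)).
    apply: (step T t (- beta) 1) => //; last by move=> ? ?; exact: w1.
    move=> s e' y /andP[Ts st] ye uv; have := u01 s e' y ye; have := v01 s e' y ye.
    move=> /andP[v0 _] /andP[_ u1]; apply: stab => //; first exact: ltW.
    by apply: early => //; exact: le_trans tT1.
  have -> : - beta * (t - T) = - w^-1.
    by rewrite /T; field; rewrite !gt_eqF.
  rewrite mul1r expRN => wle.
  have := expR_ge1Dx w^-1; have := expR_gt0 w^-1; set E := expR w^-1 in wle *.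
  move=> E0; have wE : w * E <= 1 by rewrite -ler_pdivlMr// div1r.
  move=> /(ler_wpM2l (ltW w0)); rewrite mulrDr mulr1 mulfV ?gt_eqF//; lra.
move=> t e x xe; case: (leP t T1) => [tT1|T1t]; first exact: early_le.
have [L L0 HL] := bistable_lipschitz hf.
rewrite -subr_le0 -[X in _ <= X](mul0r (expR (L * (t - T1)))).
apply: step => //; first exact: ltW.
  move=> s e' y _ ye uv; have := u01 s e' y ye; have := v01 s e' y ye.
  move=> vs01 us01; apply: (le_trans (ler_norm _)); apply: (le_trans (HL _ _ vs01 us01)).
  by rewrite ger0_norm// subr_ge0 ltW.
by move=> e' y ye; rewrite subr_le0 early_le.
Qed.

Lemma sup_nonneg (A : set R) : (forall x, A x -> 0 <= x) -> 0 <= sup A.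
Proof.
move=> A0; have [hA|/sup_out->//] := pselect (has_sup A).
by have [[x Ax] _] := hA; exact: le_trans (A0 x Ax) (sup_upper_bound hA Ax).
Qed.

(** Both suprema in the definition are nonnegative, so each tends to 0. *)
Lemma front_like_early (u : R -> gfun Om) (eps : R) : front_like f phi c i u ->
  0 < eps -> exists T0 : R, forall t, t <= T0 ->
    (forall x, 0 <= x -> `|u t (outer i) x - phi (- x - c * t)| < eps) /\
    (forall e x, e != outer i -> x \in edge_dom e -> u t e x < eps).
Proof.
move=> [us u01 /cvgrPdist_lt lim0] eps0; have [M [_ HM]] := lim0 eps eps0.
exists (M - 1) => t tM.
have /HM {HM}/= : t < M by lra.
set A := [set `|u t (outer i) x - phi (- x - c * t)| | x in [set` edge_dom (outer i)]].
set B := [set `|u t p.1 p.2| | p in _].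
rewrite sub0r normrN => /(le_lt_trans (ler_norm _)) AB.
have A0 : 0 <= sup A by apply: sup_nonneg => _ [x _ <-].
have B0 : 0 <= sup B by apply: sup_nonneg => _ [x _ <-].
have hA : has_ubound A.
  exists 1 => _ [x xi <-]; have := u01 t _ x xi; have := tw_range hphi (- x - c * t).
  by rewrite ler_norml; lra.
have hB : has_ubound B.
  exists 1 => _ [p [_ pe] <-]; have := u01 t _ _ pe.
  by rewrite ler_norml; lra.
split=> [x x0|e x ei xe].
  have : `|u t (outer i) x - phi (- x - c * t)| <= sup A.
    by apply: ub_le_sup => //; exists x => //=; rewrite in_itv /= x0.
  by lra.
have : `|u t e x| <= sup B by apply: ub_le_sup => //; exists (e, x).
by have := ler_norm (u t e x); lra.
Qed.

Lemma wave_tails (eps : R) : 0 < eps -> exists Z : R,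
  (forall z, Z <= z -> phi z < eps) /\ (forall z, z <= - Z -> 1 - eps < phi z).
Proof.
move=> e0.
have /cvgrPdist_lt/(_ eps e0) [M1 [_ H1]] := tw_plus hphi.
have /cvgrPdist_lt/(_ eps e0) [M2 [_ H2]] := tw_minus hphi.
exists (Num.max (M1 + 1) (1 - M2)); split=> z.
  rewrite ge_max =>  /andP[zM _]; have /H1 /= : M1 < z by lra.
  by rewrite sub0r normrN => /(le_lt_trans (ler_norm _)).
rewrite lerNr ge_max => /andP[_ zM]; have /H2 /= : z < M2 by lra.
by move=> /(le_lt_trans (ler_norm _)); lra.
Qed.

(** Long ago the front was still so far out on the path [i] that [v] is close
    to 1 wherever [u] is not close to 0. *)
Lemma front_like_le_supersolution (u : R -> gfun Om) (v : gfun Om) :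
  front_like f phi c i u -> supersolution f v -> between01 v ->
  tends_to_1_on i v -> forall t e x, x \in edge_dom e -> u t e x <= v e x.
Proof.
move=> fu vs v01 vlim.
have [eta [beta [eta0 beta0 eta1 stab]]] := bistable_stable hf.
have [us u01 _] := fu; have c0 := tw_speed hphi.
have e20 : 0 < eta / 2 by rewrite divr_gt0.
have [Z [Z1 _]] := wave_tails e20.
have [T0 HT0] := front_like_early fu e20.
have /cvgrPdist_lt/(_ eta eta0) [X [_ HX]] := vlim.
apply: (@ordered_of_early_stability u (fun _ => v) eta
  (Num.min T0 (- (Z + X + 1) / c))).
- exact: gap_supersolution (bistable_continuous hf) us vs.
- by move=> t e x xe; have /andP[? ?] := u01 t e x xe; rewrite !ltW.
- by move=> _; exact: v01.
- by exists beta.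
move=> t e x; rewrite le_min => /andP[tT0 tX] xe _.
have [H1 H2] := HT0 t tT0.
have [ei|ei] := eqVneq e (outer i); last by left; apply: ltW; have := H2 e x ei xe; lra.
move: xe; rewrite ei /= in_itv /= andbT => x0.
case: (ltP X x) => xX.
  right; have /= := HX x xX; move=> /(le_lt_trans (ler_norm _)).
  rewrite /outer; lra.
left; have : phi (- x - c * t) < eta / 2.
  apply: Z1; have : c * t <= - (Z + X + 1).
    by rewrite mulrC -ler_pdivlMr.
  by lra.
have := H1 x x0; rewrite ltr_norml => /andP[_]; lra.
Qed.

(** In a long time [S] the front advances by more than its width: where the
    earlier value is not close to 0, the later one is already close to 1. *)
Lemma front_like_increasing (u : R -> gfun Om) : front_like f phi c i u ->
  exists2 S : R, 0 < S & forall t e x, x \in edge_dom e -> u t e x <= u (t + S) e x.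
Proof.
move=> fu; have [eta [beta [eta0 beta0 eta1 stab]]] := bistable_stable hf.
have [us u01 _] := fu; have c0 := tw_speed hphi.
have e20 : 0 < eta / 2 by rewrite divr_gt0.
have [Z [Z1 Z2]] := wave_tails e20.
have [T0 HT0] := front_like_early fu e20.
pose S := (2 * `|Z| + 1) / c.
have S0 : 0 < S by rewrite divr_gt0// ltr_wpDl// mulr_ge0.
have cS : c * S = 2 * `|Z| + 1 by rewrite /S mulrCA mulfV ?gt_eqF// mulr1.
have ZZ := ler_norm Z.
have u01' t : between01 (u t).
  by move=> e x xe; have /andP[? ?] := u01 t e x xe; rewrite !ltW.
exists S => //; apply: (@ordered_of_early_stability u (fun t => u (t + S)) eta (T0 - S)) => //.
- exact: gap_solutions us (solution_shift S us).
- by exists beta.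
move=> t e x tT xe _.
have [|H1 H2] := HT0 t; first lra.
have [|H3 _] := HT0 (t + S); first lra.
have [ei|ei] := eqVneq e (outer i); last by left; apply: ltW; have := H2 e x ei xe; lra.
move: xe; rewrite ei /= in_itv /= andbT => x0.
case: (leP Z (- x - c * t)) => zZ.
  left; have := Z1 _ zZ; have := H1 x x0; rewrite ltr_norml => /andP[_]; lra.
right; have zZ' : - x - c * (t + S) <= - Z by rewrite mulrDr cS; have := normr_ge0 Z; lra.
have := Z2 _ zZ'; have := H3 x x0; rewrite ltr_norml => /andP[+ _]; lra.
Qed.

Lemma limit_profile_le (u : R -> gfun Om) (v vhat : gfun Om) :
  limit_profile u vhat -> (forall t e x, x \in edge_dom e -> u t e x <= v e x) ->
  gforall (fun e x => vhat e x <= v e x).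
Proof.
move=> lim uv e x xe; have cu := lim e x xe.
rewrite -(cvg_lim (@norm_hausdorff _ _) cu); apply: limr_le.
  by apply/cvg_ex; exists (vhat e x).
by near=> t; exact: uv.
Unshelve. all: by end_near. Qed.

(** The values at the times [t + n * S] increase to the limit. *)
Lemma limit_profile_ge (u : R -> gfun Om) (vhat : gfun Om) :
  front_like f phi c i u -> limit_profile u vhat ->
  forall t e x, x \in edge_dom e -> u t e x <= vhat e x.
Proof.
move=> fu lim t e x xe; have [S S0 incr] := front_like_increasing fu.
have incrn n : u t e x <= u (t + n%:R * S) e x.
  elim: n => [|n IH]; first by rewrite mul0r addr0.
  by apply: (le_trans IH); rewrite -addn1 natrD mulrDl mul1r addrA; exact: incr.
rewrite leNgt; apply/negP => lt_v.
have d0 : 0 < u t e x - vhat e x by rewrite subr_gt0.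
have /cvgrPdist_lt/(_ _ d0) [M [_ HM]] := lim e x xe.
pose n := Num.truncn (Num.max ((M - t) / S) 0).
have : M < t + n.+1%:R * S.
  have : Num.max ((M - t) / S) 0 < n.+1%:R.
    by apply: truncnS_gt.
  rewrite gt_max => /andP[+ _]; rewrite ltr_pdivrMr//; lra.
move=> /HM /=; rewrite distrC => /(le_lt_trans (ler_norm _)).
have := incrn n.+1; lra.
Qed.

Lemma limit_profile_tends_to_1 (u : R -> gfun Om) (vhat : gfun Om) :
  front_like f phi c i u -> limit_profile u vhat -> between01 vhat ->
  tends_to_1_on i vhat.
Proof.
move=> fu lim v01; apply/cvgrPdist_lt => eps eps0.
have e20 : 0 < eps / 2 by rewrite divr_gt0.
have [Z [_ Z2]] := wave_tails e20.
have [T0 HT0] := front_like_early fu e20.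
have [H _] := HT0 T0 (lexx _).
near=> x.
have x0 : 0 <= x by near: x; exact: nbhs_pinfty_ge.
have xi : x \in edge_dom (outer i) by rewrite /= in_itv /= x0.
have := limit_profile_ge fu lim T0 xi.
have : - x - c * T0 <= - Z.
  suff : Z - c * T0 <= x by lra.
  by near: x; apply: nbhs_pinfty_ge; exact: num_real.
move=> /Z2; have := H x x0; rewrite ltr_norml => /andP[+ _].
have := v01 _ x xi; move=> /andP[_ v1].
by rewrite ger0_norm ?subr_ge0//; lra.
Unshelve. all: by end_near. Qed.

End FrontLike.

Section StationarySuper.
Variables (R : realType) (Om : star_graph R) (f : R -> R).

Lemma stationary_supersolution (v : gfun Om) : stationary_solution f v ->
  supersolution f v.
Proof.
move=> vs; split.
- move=> e; have /subspace_continuousP cv := sol_continuous vs (e := e).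
  apply/subspace_continuousP => x xe A nA.
  have := cv (0, x) xe A nA; rewrite /nbhs /= => -[[A1 A2] /= [n1 n2] H].
  apply: filterS n2 => y A2y ye; apply: (H (0, y)) => //; split=> //=.
  exact: nbhs_singleton.
- exact: (sol_vertex vs 0).
- move=> e; exists set0; split; first by move=> M; rewrite set0I; exact: finite_set0.
  move=> p q pq pe qe _; have [dg [cdg H]] := sol_C1 vs e 0.
  have sub x : x \in `[p, q] -> x \in edge_dom e.
    rewrite in_itv /= => /andP[px xq]; move: pe qe.
    case: e {cdg H} => [e|j] /=; rewrite !in_itv /= ?andbT => pe qe.
      by case/andP: pe => p0 _; case/andP: qe => _ ql; rewrite (le_trans p0) ?(le_trans xq).
    exact: le_trans px.
  exists dg; split; first by apply: continuous_subspaceW cdg => x; exact: sub.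
  move=> x xpq; apply: cvg_trans (H x (sub x xpq)).
  apply: cvg_app => A nA.
  have nA' : nbhs x [set y | y \in edge_dom e /\ y != x -> A y] := nA.
  suff : nbhs x [set y | y \in `[p, q] /\ y != x -> A y] by [].
  by apply: filterS nA' => y Ay [ypq yx]; apply: Ay; split=> //; exact: sub.
- move=> e; left => x xe; have [_ [tw E]] := sol_equation vs 0 xe.
  split=> //; rewrite -E; suff -> : derive1 (fun _ : R => v e x) 0 = 0 by [].
  exact: is_derive_derive1.
- by move=> V; rewrite (sol_kirchhoff vs 0).
Qed.

End StationarySuper.

(** * Comparison on short stars *)

Section HeatOperator.
Variable R : realType.
Implicit Types (U V : R -> R -> R) (t x y m A B : R).

(** The heat operator, time derivative minus second space derivative, of [U]
    at [(t, x)] exists and equals [m]. *)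
Definition heat_at U t x m := exists (U1 : R -> R) (U2 l d : R),
  [/\ 0 < d, forall y, `|y - x| < d -> is_derive y 1 (U t) (U1 y),
      is_derive x 1 U1 U2, is_derive t 1 (fun s => U s x) l & m = l - U2].

Lemma heat_at_opp U t x m : heat_at U t x m -> heat_at (fun t x => - U t x) t x (- m).
Proof.
move=> [U1 [U2 [l [d [d0 dU dU1 dl ->]]]]].
exists (fun y => - U1 y), (- U2), (- l), d; split=> //.
- by move=> y /dU; exact: is_derive_oppf.
- exact: is_derive_oppf.
- exact: is_derive_oppf.
- by ring.
Qed.

Lemma heat_at_addr U (F F1 : R -> R) t x m (d F2 : R) : 0 < d ->
  (forall y, `|y - x| < d -> is_derive y 1 F (F1 y)) -> is_derive x 1 F1 F2 ->
  heat_at U t x m -> heat_at (fun t x => U t x + F x) t x (m - F2).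
Proof.
move=> d0 dF dF1 [U1 [U2 [l [r [r0 dU dU1 dl ->]]]]].
exists (fun y => U1 y + F1 y), (U2 + F2), (l + 0), (Num.min d r); split=> //.
- by rewrite lt_min d0.
- by move=> y; rewrite lt_min => /andP[/dF ? /dU ?]; exact: is_derive_addf.
- exact: is_derive_addf.
- exact: is_derive_addf dl (is_derive_cst (F x) t 1).
- by ring.
Qed.

Lemma heat_at_shift U t x m (c : R) : heat_at U t (c + x) m ->
  heat_at (fun t x => U t (c + x)) t x m.
Proof.
move=> [U1 [U2 [l [d [d0 dU dU1 dl ->]]]]].
have sh (g : R -> R) y g' : is_derive (c + y) 1 g g' -> is_derive y 1 (fun z => g (c + z)) g'.
  move=> dg; rewrite (_ : (fun z => g (c + z)) = (fun z => g (z - - c))).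
    by apply: is_derive_shift; rewrite opprK addrC.
  by apply/funext => z; rewrite opprK addrC.
exists (fun y => U1 (c + y)), U2, l, d; split=> //; last exact: sh.
move=> y yx; apply: sh; apply: dU; by rewrite opprD addrACA subrr add0r.
Qed.

Lemma heat_at_reflect U t x m (c : R) : heat_at U t (c - x) m ->
  heat_at (fun t x => U t (c - x)) t x m.
Proof.
move=> [U1 [U2 [l [d [d0 dU dU1 dl ->]]]]].
exists (fun y => - U1 (c - y)), U2, l, d; split=> //.
- move=> y yx; apply: is_derive_reflect; apply: dU.
  have -> : c - y - (c - x) = - (y - x) by ring.
  by rewrite normrN.
- by rewrite -[U2]opprK; apply: is_derive_oppf; exact: is_derive_reflect.
Qed.

(** Comparison on a star of intervals [0, r k] joined at their origins, with
    the stationary barrier [beta + s k * x + A / 2 * x ^+ 2], whose Kirchhoff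
    sum and values at the tips lie on the good side. The initial excess [N] is carried
    by the concave profile [3 - x / L - (x / L) ^+ 2], which makes it decay. *)
Lemma star_comparison (K : finType) (rho r s : K -> R) (U : K -> R -> R -> R)
    (T beta A N L : R) :
  0 < L -> 0 < N -> (forall k, 0 < rho k) -> (forall k, 0 < r k <= L) ->
  0 <= \sum_k rho k * s k ->
  (forall k, {within [set p : R * R | p.2 \in `[0, r k]],
     continuous (fun p => U k p.1 p.2)}) ->
  (forall k l t, U k t 0 = U l t 0) ->
  (forall t, T < t -> exists p : K -> R, (forall k, rderiv (U k t) (p k)) /\
     \sum_k rho k * p k <= 0) ->
  (forall k t x, T < t -> 0 < x < r k -> exists2 m, heat_at (U k) t x m & - A <= m) ->
  (forall k t, T <= t -> beta + s k * r k + A / 2 * r k ^+ 2 <= U k t (r k)) ->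
  (forall k x, 0 <= x <= r k -> beta + s k * x + A / 2 * x ^+ 2 - N <= U k T x) ->
  forall k t x, T <= t -> 0 <= x <= r k ->
    beta + s k * x + A / 2 * x ^+ 2 - 3 * N * expR (- (2 * L ^+ 2)^-1 * (t - T))
      <= U k t x.
Proof.
move=> L0 N0 rho0 rL sums cU vU kU hU latU initU ks ts xs Tts xsr.
pose mu := (2 * L ^+ 2)^-1.
have L20 : 0 < L ^+ 2 by rewrite exprn_gt0.
have mu0 : 0 < mu by rewrite invr_gt0 mulr_gt0.
pose h x := 3 - x / L - (x / L) ^+ 2.
pose c t := N * expR (- mu * (t - T)).
have c0 t : 0 < c t by rewrite mulr_gt0// expR_gt0.
pose z k t x := beta + s k * x + A / 2 * x ^+ 2 - c t * h x - U k t x.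
have hb k x : 0 <= x <= r k -> 1 <= h x <= 3.
  move=> /andP[x0 xr]; have xL : 0 <= x / L <= 1.
    rewrite divr_ge0 ?(ltW L0)//= ler_pdivrMr// mul1r (le_trans xr)//.
    by have /andP[] := rL k.
  by rewrite /h; move: xL; set q := x / L => /andP[q0 q1]; apply/andP; split; nra.
suff zs : z ks ts xs <= 0.
  have /andP[_ h3] := hb ks xs xsr.
  have := ler_wpM2l (ltW (c0 ts)) h3; move: zs; rewrite /z /c /mu; lra.
rewrite leNgt; apply/negP => zs0.
have r0 k : 0 <= r k by have /andP[/ltW] := rL k.
have cz k : {within [set p : R * R | p.1 \in `[T, ts] /\ p.2 \in `[0, r k]],
    continuous (fun p => z k p.1 p.2)}.
  have cUk : {within [set p : R * R | p.1 \in `[T, ts] /\ p.2 \in `[0, r k]],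
      continuous (fun p => U k p.1 p.2)}.
    by apply: continuous_subspaceW (cU k) => p /= [].
  have q1 : continuous (fun x => beta + s k * x + A / 2 * x ^+ 2).
    have := continuous_is_derive (fun x => is_derive_parabola beta (s k) A 0 x).
    by under eq_fun do rewrite subr0.
  have q2 : continuous h.
    have := continuous_is_derive (fun x => is_derive_parabola 3 (- L^-1) (- 2 / L ^+ 2) 0 x).
    rewrite (_ : (fun y => _) = h)//; apply/funext => y; rewrite /h subr0.
    by field; rewrite gt_eqF.
  have q3 : continuous c.
    exact: (continuous_is_derive (fun t => is_derive_scalef N (is_derive_expR_scaled (- mu) T t))).
  have q4 : continuous (fun p : R * R =>
      beta + s k * p.2 + A / 2 * p.2 ^+ 2 - c p.1 * h p.2).
    move=> p; apply: cvgB; first exact: (continuous_snd_comp q1).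
    by apply: cvgM; [exact: (continuous_fst_comp q3)|exact: (continuous_snd_comp q2)].
  by move=> p; apply: cvgB; [exact: (continuous_subspaceT q4)|exact: cUk].
have [k0 [t0 [x0 [t0T x0r zmax]]]] := family_max ks Tts r0 cz.
have tsT : T <= ts <= ts by rewrite Tts lexx.
have zpos : 0 < z k0 t0 x0 by exact: lt_le_trans zs0 (zmax _ _ _ tsT xsr).
have [h1 h3] := andP (hb _ _ x0r).
have Tt0 : T < t0.
  rewrite lt_neqAle; case/andP: (t0T) => -> _; rewrite andbT.
  apply/eqP => Et0; move: zpos; rewrite /z /c -Et0 subrr mulr0 expR0 mulr1.
  have := initU k0 x0 x0r; have := ler_wpM2l (ltW N0) h1; lra.
have x0lt : x0 < r k0.
  rewrite lt_neqAle; case/andP: (x0r) => _ ->; rewrite andbT.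
  apply/eqP => Ex0; move: zpos; rewrite /z Ex0.
  have := latU k0 t0 (ltW Tt0); have := mulr_gt0 (c0 t0) (lt_le_trans ltr01 h1).
  by rewrite Ex0; lra.
have xquad k t x : z k t x = (beta - 3 * c t) + (s k + c t / L) * (x - 0) +
    (A + 2 * c t / L ^+ 2) / 2 * (x - 0) ^+ 2 - U k t x.
  by rewrite /z /h subr0; field; rewrite gt_eqF.
case/andP: (x0r); rewrite le_eqVlt => /orP[/eqP x00|x0gt] _.
  have [p [dp sp]] := kU t0 Tt0.
  have dz k : rderiv (z k t0) (s k + c t0 / L + -1 * p k).
    have d1 := is_derive_rderiv (is_derive_parabola (beta - 3 * c t0) (s k + c t0 / L)
       (A + 2 * c t0 / L ^+ 2) 0 0).
    apply: (rderiv_eq (rderivD d1 (rderivZ (a := -1) (dp k)))).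
      by rewrite subrr mulr0 addr0.
    by move=> x; rewrite add0r xquad mulN1r.
  have z0 k : z k t0 0 = z k0 t0 x0.
    by rewrite -x00 /z (vU k k0) !mulr0 expr0n /= !mulr0.
  have dz0 k : s k + c t0 / L + -1 * p k <= 0.
    apply: (@rderiv_le0 _ _ _ (r k)) (dz k); first by have /andP[] := rL k.
    by move=> y /andP[y0 yr]; rewrite z0; apply: zmax => //; rewrite !ltW.
  have : \sum_k rho k * (s k + c t0 / L + -1 * p k) <= 0.
    by apply: sumr_le0 => k _; rewrite mulr_ge0_le0// ltW.
  apply/negP; rewrite -ltNge.
  under eq_bigr do rewrite mulN1r mulrDr mulrDr mulrN.
  rewrite big_split big_split /= sumrN -mulr_suml.
  have : 0 < \sum_k rho k.
    by rewrite (bigD1 k0)//= ltr_wpDr// sumr_ge0// => k _; exact: ltW.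
  by move=> /mulr_gt0/(_ (divr_gt0 (c0 t0) L0)); lra.
have [|m [U1 [U2 [l [d [d0 dU dU1 dl mE]]]]] Am] := hU k0 t0 x0 Tt0.
  by rewrite x0gt.
pose d' := Num.min d (Num.min x0 (r k0 - x0)).
have d'0 : 0 < d' by rewrite !lt_min d0 x0gt subr_gt0.
have : A + 2 * c t0 / L ^+ 2 - U2 <= 0.
  apply: (second_order_max (g := z k0 t0)
    (k := fun y => (s k0 + c t0 / L) + (A + 2 * c t0 / L ^+ 2) * (y - 0) - U1 y) d'0).
  - move=> y; rewrite lt_min => /andP[/dU dUy _].
    rewrite (_ : z k0 t0 = fun x => (beta - 3 * c t0) + (s k0 + c t0 / L) * (x - 0) +
      (A + 2 * c t0 / L ^+ 2) / 2 * (x - 0) ^+ 2 - U k0 t0 x).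
      exact: is_derive_subf (is_derive_parabola _ _ _ _ _) dUy.
    by apply/funext => x; exact: xquad.
  - exact: is_derive_subf (is_derive_affine _ _ _ _) dU1.
  - move=> y; rewrite !lt_min => /and3P[_]; rewrite !ltr_norml => /andP[? ?] /andP[? ?].
    by apply: zmax => //; apply/andP; split; lra.
have dzt : is_derive t0 1 (fun t => z k0 t x0) (- (h x0 * (N * (- mu * expR (- mu * (t0 - T))))) - l).
  rewrite (_ : (fun t => z k0 t x0) = fun t => (beta + s k0 * x0 + A / 2 * x0 ^+ 2) +
     - (h x0 * (N * expR (- mu * (t - T)))) - U k0 t x0); last first.
    by apply/funext => t; rewrite /z /c; ring.
  apply: is_derive_subf dl; rewrite -[X in is_derive _ _ _ X]add0r.
  apply: is_derive_addf; apply: is_derive_oppf; apply: is_derive_scalef; apply: is_derive_scalef; exact: is_derive_expR_scaled.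
have /(is_derive_ge0_left_max Tt0 dzt) : forall t, T <= t <= t0 -> z k0 t x0 <= z k0 t0 x0.
  move=> t /andP[Tt tt0]; apply: zmax => //; rewrite Tt /=.
  by case/andP: t0T => _; exact: le_trans.
have -> : - (h x0 * (N * (- mu * expR (- mu * (t0 - T))))) = mu * c t0 * h x0.
  by rewrite /c; ring.
have := ler_wpM2l (ltW (mulr_gt0 mu0 (c0 t0))) h3.
have -> : 2 * c t0 / L ^+ 2 = 4 * (mu * c t0) by rewrite /mu; field; rewrite gt_eqF.
have := mulr_gt0 mu0 (c0 t0); lra.
Qed.

Definition chord (y0 y1 b0 b1 x : R) := b0 + (b1 - b0) / (y1 - y0) * (x - y0).

(** An interval is a star with two branches, centred at its midpoint. *)
Lemma interval_comparison U (y0 y1 T b0 b1 A N : R) :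
  y0 < y1 -> 0 <= A -> 0 < N ->
  {within [set p : R * R | p.2 \in `[y0, y1]], continuous (fun p => U p.1 p.2)} ->
  (forall t x, T < t -> y0 < x < y1 -> exists2 m, heat_at U t x m & - A <= m) ->
  (forall t, T <= t -> b0 <= U t y0 /\ b1 <= U t y1) ->
  (forall x, y0 <= x <= y1 -> b0 - N <= U T x /\ b1 - N <= U T x) ->
  forall t x, T <= t -> y0 <= x <= y1 ->
    chord y0 y1 b0 b1 x - A / 2 * ((x - y0) * (y1 - x)) -
      3 * N * expR (- (2 * (y1 - y0) ^+ 2)^-1 * (t - T)) <= U t x.
Proof.
move=> y01 A0 N0 cU hU latU initU t x Tt xy.
pose m := (y0 + y1) / 2; pose r := (y1 - y0) / 2.
pose sg := (b1 - b0) / (y1 - y0).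
pose beta := (b0 + b1) / 2 - A / 2 * r ^+ 2.
have r0 : 0 < r by rewrite divr_gt0// subr_gt0.
have sgr : sg * r = (b1 - b0) / 2 by rewrite /sg /r; field; rewrite gt_eqF// subr_gt0.
pose W (k : bool) t x := if k then U t (m + x) else U t (m - x).
pose s (k : bool) := if k then sg else - sg.
pose q (k : bool) x := if k then m + x else m - x.
have qr k y : 0 <= y <= r -> y0 <= q k y <= y1.
  by case: k; rewrite /q /m /r => /andP[? ?]; apply/andP; split; lra.
have zetaE k y : beta + s k * y + A / 2 * y ^+ 2 =
   chord y0 y1 b0 b1 (q k y) - A / 2 * ((q k y - y0) * (y1 - q k y)).
  by rewrite /beta /chord; case: k; rewrite /s /q /sg /m /r; field;
    rewrite gt_eqF// subr_gt0.
have lam01 y : y0 <= y <= y1 -> 0 <= (y - y0) / (y1 - y0) <= 1.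
  move=> /andP[? ?]; rewrite divr_ge0 ?subr_ge0 ?(ltW y01)//=.
  by rewrite ler_pdivrMr ?subr_gt0// mul1r lerB.
have chordE y : chord y0 y1 b0 b1 y = b0 + (b1 - b0) * ((y - y0) / (y1 - y0)).
  by rewrite /chord mulrAC -!mulrA.
have := @star_comparison bool (fun _ => 1) (fun _ => r) s W T beta A N (y1 - y0).
rewrite subr_gt0 => /(_ y01 N0 (fun _ => ltr01)).
have rL (k : bool) : 0 < r <= y1 - y0 by rewrite r0 /r; lra.
move=> /(_ rL) {rL}.
have ss : 0 <= \sum_(k : bool) 1 * s k by rewrite big_bool /= /s !mul1r addrN.
move=> /(_ ss) H.
have {H}H : forall k t y, T <= t -> 0 <= y <= r ->
   beta + s k * y + A / 2 * y ^+ 2 -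
     3 * N * expR (- (2 * (y1 - y0) ^+ 2)^-1 * (t - T)) <= W k t y.
  apply: H.
  - move=> k; case: k; rewrite /W.
      have -> : (fun p : R * R => U p.1 (m + p.2)) =
        (fun p => U p.1 p.2) \o (fun p : R * R => (p.1, m + 1 * p.2)).
        by apply/funext => p /=; rewrite mul1r.
      apply: within_comp cU; first exact: continuous_shift_snd.
      by move=> p /=; rewrite !in_itv /= mul1r => /(qr true).
    have -> : (fun p : R * R => U p.1 (m - p.2)) =
      (fun p => U p.1 p.2) \o (fun p : R * R => (p.1, m + -1 * p.2)).
      by apply/funext => p /=; rewrite mulN1r.
    apply: within_comp cU; first exact: continuous_shift_snd.
    by move=> p /=; rewrite !in_itv /= mulN1r => /(qr false).
  - by case=> -[] t'; rewrite /W ?addr0 ?subr0.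
  - move=> t' Tt'; have [|m' [U1 [U2 [l [d [d0 dU _ _ _]]]]] _] := hU t' m Tt'.
      by rewrite /m; apply/andP; split; lra.
    have dm : is_derive m 1 (U t') (U1 m) by apply: dU; rewrite subrr normr0.
    exists (fun k : bool => if k then U1 m else - U1 m); split.
      by case; [exact: is_derive_rderiv|exact: is_derive_rderivN].
    by rewrite big_bool /= !mul1r subrr.
  - move=> k t' y Tt' /andP[y0' yr].
    have : y0 < q k y < y1.
      by move: y0' yr; case: k; rewrite /q /m /r; move=> ? ?; apply/andP; split; lra.
    move=> /(hU _ _ Tt')[m' hm Am]; exists m' => //.
    by case: k hm; rewrite /W /q; [exact: heat_at_shift|exact: heat_at_reflect].
  - move=> k t' /latU[L0 L1]; rewrite zetaE.
    have y10 : y1 - y0 != 0 by rewrite gt_eqF// subr_gt0.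
    have q1 : q true r = y1 by rewrite /q /m /r; lra.
    have q0 : q false r = y0 by rewrite /q /m /r; lra.
    have -> : W k t' r = U t' (q k r) by case: k.
    have e0 : chord y0 y1 b0 b1 y0 = b0 by rewrite /chord subrr mulr0 addr0.
    have e1 : chord y0 y1 b0 b1 y1 = b1 by rewrite /chord divfK// subrKC.
    by case: k; rewrite ?q1 ?q0 ?e0 ?e1; lra.
  - move=> k y yr; rewrite zetaE; have qy := qr k y yr.
    have -> : W k T y = U T (q k y) by case: (k).
    have [I0 I1] := initU _ qy; rewrite chordE.
    have /andP[? ?] := qy.
    have : 0 <= A / 2 * ((q k y - y0) * (y1 - q k y)).
      by rewrite !mulr_ge0 ?subr_ge0// invr_ge0.
    by have := lam01 _ qy; set la := (_ / _) => /andP[? ?]; nra.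
pose k := m <= x; pose y := `|x - m|.
have qx : q k y = x.
  by rewrite /q /k /y; case: (leP m x) => mx; [rewrite ger0_norm ?subr_ge0|
    rewrite ltr0_norm ?subr_lt0]; lra.
have yr : 0 <= y <= r.
  by rewrite normr_ge0 /= /y ler_norml /m /r; case/andP: xy => ? ?; apply/andP; split; lra.
have -> : U t x = W k t y by rewrite -{1}qx /W /q; case: (k).
by have := H k t y Tt yr; rewrite zetaE qx.
Qed.

End HeatOperator.

(** * Limits for large times *)

Section LongTimeLimits.
Variable R : realType.
Implicit Types (U : R -> R -> R) (V : R -> R).

Lemma cvg_pinfty_eps (g : R -> R) (l eps : R) : g t @[t --> +oo] --> l -> 0 < eps ->
  exists T : R, forall t, T <= t -> `|g t - l| < eps.
Proof.
move=> /cvgrPdist_lt gl e0; have [M [_ HM]] := gl eps e0.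
exists (M + 1) => t Mt; rewrite distrC; apply: HM; lra.
Qed.

Lemma le_max3 (a b c : R) (m := Num.max a (Num.max b c)) :
  a <= m /\ b <= m /\ c <= m.
Proof. by rewrite /m !le_max !lexx !orbT. Qed.

(** The hypotheses under which the long time limit [V] of [U] on [y0, y1] is
    compared with chords. *)
Record evolves_to (U : R -> R -> R) (V : R -> R) (y0 y1 A B : R) : Prop := {
  ev_continuous : {within [set p : R * R | p.2 \in `[y0, y1]],
     continuous (fun p => U p.1 p.2)};
  ev_heat : exists T : R, forall t x, T < t -> y0 < x < y1 ->
     exists2 m, heat_at U t x m & - A <= m;
  ev_bound : forall t x, y0 <= x <= y1 -> `|U t x| <= B;
  ev_lim : forall x, y0 <= x <= y1 -> U t x @[t --> +oo] --> V x }.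

Lemma evolves_sub U V (y0 y1 z0 z1 A B : R) : y0 <= z0 -> z1 <= y1 ->
  evolves_to U V y0 y1 A B -> evolves_to U V z0 z1 A B.
Proof.
move=> yz0 zy1 [cU [T hU] bU lU].
have sub x : z0 <= x <= z1 -> y0 <= x <= y1.
  by move=> /andP[zx xz]; rewrite (le_trans yz0 zx) (le_trans xz).
split; last 2 first.
- by move=> t x /sub; exact: bU.
- by move=> x /sub; exact: lU.
- by apply: continuous_subspaceW cU => p /=; rewrite !in_itv /=; exact: sub.
exists T => t x Tt /andP[zx xz]; apply: hU => //.
by rewrite (le_lt_trans yz0 zx) (lt_le_trans xz).
Qed.

Lemma evolves_chord_eventually U V (y0 y1 A B eps : R) : y0 < y1 -> 0 <= A ->
  evolves_to U V y0 y1 A B -> 0 < eps ->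
  exists T : R, forall t x, T <= t -> y0 <= x <= y1 ->
    chord y0 y1 (V y0) (V y1) x - A / 2 * ((x - y0) * (y1 - x)) - eps <= U t x.
Proof.
move=> y01 A0 [cU [T0 hU] bU lU] e0.
have e20 : 0 < eps / 2 by rewrite divr_gt0.
have Y0 : y0 <= y0 <= y1 by rewrite lexx ltW.
have Y1 : y0 <= y1 <= y1 by rewrite lexx ltW.
have [T1 H1] := cvg_pinfty_eps (lU _ Y0) e20.
have [T2 H2] := cvg_pinfty_eps (lU _ Y1) e20.
have B0 : 0 <= B by exact: le_trans (normr_ge0 _) (bU 0 y0 Y0).
pose T := Num.max T0 (Num.max T1 T2).
have [TT0 [TT1 TT2]] : T0 <= T /\ T1 <= T /\ T2 <= T.
  exact: le_max3.
pose N := 2 * B + 1; have N0 : 0 < N by rewrite /N; lra.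
have rate : 0 < (2 * (y1 - y0) ^+ 2)^-1.
  by rewrite invr_gt0 mulr_gt0// exprn_gt0// subr_gt0.
have N3 : 0 < 3 * N by rewrite mulr_gt0.
have [T3 H3] := expR_decay T rate N3 e20.
exists (Num.max T T3) => t x; rewrite ge_max => /andP[Tt T3t] xy.
have lat s : T <= s -> V y0 - eps / 2 <= U s y0 /\ V y1 - eps / 2 <= U s y1.
  move=> Ts; have := H1 s (le_trans TT1 Ts); have := H2 s (le_trans TT2 Ts).
  by rewrite !ltr_norml => /andP[? ?] /andP[? ?]; split; lra.
have init z : y0 <= z <= y1 -> V y0 - eps / 2 - N <= U T z /\ V y1 - eps / 2 - N <= U T z.
  move=> zy; have [L0 L1] := lat T (lexx T).
  have := bU T z zy; have := bU T _ Y0; have := bU T _ Y1; rewrite /N !ler_norml.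
  by move=> /andP[? ?] /andP[? ?] /andP[? ?]; split; lra.
have hU' s z : T < s -> y0 < z < y1 -> exists2 m, heat_at U s z m & - A <= m.
  by move=> Ts; apply: hU; exact: le_lt_trans Ts.
have := interval_comparison y01 A0 N0 cU hU' lat init Tt xy.
have -> : chord y0 y1 (V y0 - eps / 2) (V y1 - eps / 2) x =
  chord y0 y1 (V y0) (V y1) x - eps / 2.
  by rewrite /chord; ring.
by have := H3 t T3t; lra.
Qed.

Lemma evolves_chord U V (y0 y1 A B : R) : y0 < y1 -> 0 <= A ->
  evolves_to U V y0 y1 A B -> forall x, y0 <= x <= y1 ->
  chord y0 y1 (V y0) (V y1) x - A / 2 * ((x - y0) * (y1 - x)) <= V x.
Proof.
move=> y01 A0 ev x xy; apply/ler_addgt0Pr => eps e0.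
have e20 : 0 < eps / 2 by rewrite divr_gt0.
have [T1 H1] := evolves_chord_eventually y01 A0 ev e20.
have [T2 H2] := cvg_pinfty_eps (ev_lim ev xy) e20.
pose T := Num.max T1 T2.
have [TT1 TT2] : T1 <= T /\ T2 <= T by rewrite /T !le_max !lexx !orbT.
by have := H1 T x TT1 xy; have := H2 T TT2; rewrite ltr_norml => /andP[_ ?]; lra.
Qed.

(** The chord estimate holds on short intervals with a common error, whence a
    convergence uniform on compact intervals. *)
Lemma evolves_uniform U V (y0 y1 A B Lip : R) : y0 < y1 -> 0 <= A -> 0 <= Lip ->
  evolves_to U V y0 y1 A B ->
  (forall x y, y0 <= x <= y1 -> y0 <= y <= y1 -> `|V x - V y| <= Lip * `|x - y|) ->
  forall eps, 0 < eps -> exists T : R, forall t x, T <= t -> y0 <= x <= y1 ->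
    V x - eps <= U t x.
Proof.
move=> y01 A0 Lip0 ev lipV eps e0.
have e20 : 0 < eps / 2 by rewrite divr_gt0.
pose rho := Num.min 1 (eps / 8 / (1 + Lip + A)).
have LA : 0 < 1 + Lip + A by lra.
have rho0 : 0 < rho by rewrite lt_min ltr01 !divr_gt0.
have rho1 : rho <= 1 by rewrite ge_min lexx.
have rhoe : rho * (1 + Lip + A) <= eps / 8.
  by rewrite -ler_pdivlMr// ge_min lexx orbT.
have := compact_near_coveringP (`[y0, y1]%classic : set R).
move=> [/(_ (@segment_compact _ _ _)) ncov _].
have := ncov R (+oo : set_system R) (fun t x => y0 <= x <= y1 -> V x - eps <= U t x).
have cov x : [set` `[y0, y1]] x -> \forall x' \near x & i \near +oo,
    y0 <= x' <= y1 -> V x' - eps <= U i x'.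
  rewrite /= in_itv /= => xy; have /andP[y0x xy1] := xy.
  pose z0 := Num.max y0 (x - rho); pose z1 := Num.min y1 (x + rho).
  have z01 : z0 < z1.
    by rewrite /z0 /z1 gt_max !lt_min; apply/andP; split; apply/andP; split; lra.
  have yz0 : y0 <= z0 by rewrite le_max lexx.
  have zy1 : z1 <= y1 by rewrite ge_min lexx.
  have xz0 : x - rho <= z0 by rewrite le_max lexx orbT.
  have xz1 : z1 <= x + rho by rewrite ge_min lexx orbT.
  have [T HT] := evolves_chord_eventually z01 A0 (evolves_sub yz0 zy1 ev) e20.
  exists ([set x' | `|x' - x| < rho], [set t | T <= t]) => /=.
    split; first by exists rho => //= x' /=; rewrite distrC.
    exists T; split; first exact: num_real.
    by move=> t; exact: ltW.
  move=> [x' t] /= [xx' Tt] xy'; have /andP[y0x' x'y1] := xy'.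
  have zx' : z0 <= x' <= z1.
    rewrite /z0 /z1 ge_max le_min y0x' x'y1 /=.
    by move: xx'; rewrite ltr_norml => /andP[? ?]; apply/andP; split; lra.
  have /andP[zx0 zx1] := zx'.
  apply: le_trans (HT t x' Tt zx').
  have V0 : V x' - Lip * (2 * rho) <= V z0.
    have Z0 : y0 <= z0 <= y1 by rewrite yz0 ltW// (lt_le_trans z01).
    have := lipV x' z0 xy' Z0; have : `|x' - z0| <= 2 * rho.
      by rewrite ger0_norm ?subr_ge0//; lra.
    by move=> /(ler_wpM2l Lip0); have := ler_norm (V x' - V z0); lra.
  have V1 : V x' - Lip * (2 * rho) <= V z1.
    have Z1 : y0 <= z1 <= y1 by rewrite zy1 andbT ltW// (le_lt_trans yz0).
    have := lipV x' z1 xy' Z1; have : `|x' - z1| <= 2 * rho.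
      by rewrite ler0_norm ?subr_le0//; lra.
    by move=> /(ler_wpM2l Lip0); have := ler_norm (V x' - V z1); lra.
  have chE : chord z0 z1 (V z0) (V z1) x' =
     (1 - (x' - z0) / (z1 - z0)) * V z0 + (x' - z0) / (z1 - z0) * V z1.
    by rewrite /chord; field; rewrite gt_eqF// subr_gt0.
  have la : 0 <= (x' - z0) / (z1 - z0) <= 1.
    rewrite divr_ge0 ?subr_ge0 ?(ltW z01)//=.
    by rewrite ler_pdivrMr ?subr_gt0// mul1r lerB.
  have ch : V x' - Lip * (2 * rho) <= chord z0 z1 (V z0) (V z1) x'.
    by rewrite chE; move: la; set la := (_ / _) => /andP[? ?]; nra.
  have : (x' - z0) * (z1 - x') <= 2 * rho * (2 * 1).
    by apply: ler_pM; rewrite ?subr_ge0//; lra.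
  move=> /(ler_wpM2l A0); lra.
move=> /(_ _ cov) [M [_ HM]]; exists (M + 1) => t x Mt xy.
have Mt1 : M < t by lra.
by apply: (HM t Mt1 x) => //; rewrite /= in_itv.
Qed.

(** For a short star of radius [r] the barrier bounds the value at the centre
    from below by the weighted mean of the values at the tips, up to [O(r ^ 2)];
    dividing by [r] leaves the Kirchhoff inequality. *)
Lemma evolves_kirchhoff (K : finType) (rho p : K -> R) (U : K -> R -> R -> R)
    (V : K -> R -> R) (r0 A B : R) :
  0 < r0 -> 0 <= A -> (forall k, 0 < rho k) ->
  (forall k, evolves_to (U k) (V k) 0 r0 A B) ->
  (forall k l t, U k t 0 = U l t 0) ->
  (forall t, exists q : K -> R, (forall k, rderiv (U k t) (q k)) /\
     \sum_k rho k * q k <= 0) ->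
  (forall k, rderiv (V k) (p k)) ->
  \sum_k rho k * p k <= 0.
Proof.
move=> r00 A0 rho0 ev vU kU dp.
have [k0 _|K0] := pickP (xpredT : pred K); last by rewrite big_pred0.
pose W := \sum_k rho k.
have W0 : 0 < W.
  by rewrite /W (bigD1 k0)//= ltr_wpDr// sumr_ge0// => k _; exact: ltW.
have V0 k : V k 0 = V k0 0.
  have I0 : 0 <= (0 : R) <= r0 by rewrite lexx ltW.
  rewrite -(cvg_lim (@norm_hausdorff _ _) (ev_lim (ev k) I0)).
  rewrite -(cvg_lim (@norm_hausdorff _ _) (ev_lim (ev k0) I0)).
  by rewrite (_ : (fun t => U k t 0) = (fun t => U k0 t 0))//; apply/funext => t; exact: vU.
have key h : 0 < h < r0 ->
    \sum_k rho k * V k h <= W * V k0 0 + W * (A / 2) * h ^+ 2.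
  move=> /andP[h0 hr]; apply/ler_addgt0Pr => eps' e'0.
  pose eps := eps' / (4 * W); have e0 : 0 < eps by rewrite divr_gt0// mulr_gt0.
  have Hh : 0 <= h <= r0 by rewrite !ltW.
  have I0 : 0 <= (0 : R) <= r0 by rewrite lexx ltW.
  have [T1 HT1] : exists T1 : R, forall k t, T1 <= t -> `|U k t h - V k h| < eps.
    have /choice[Tk HTk] : forall k, exists T : R, forall t, T <= t -> `|U k t h - V k h| < eps.
      by move=> k; exact: cvg_pinfty_eps (ev_lim (ev k) Hh) e0.
    exists (\sum_k `|Tk k|) => k t; rewrite (bigD1 k)//= => Tt; apply: HTk.
    have := ler_norm (Tk k); have : 0 <= \sum_(i | i != k) `|Tk i| by exact: sumr_ge0.
    lra.
  have [T2 HT2] : exists T2 : R, forall k t x, T2 < t -> 0 < x < h ->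
      exists2 m, heat_at (U k) t x m & - A <= m.
    have /choice[Tk HTk] : forall k, exists T : R, forall t x, T < t -> 0 < x < r0 ->
        exists2 m, heat_at (U k) t x m & - A <= m.
      by move=> k; exact: ev_heat (ev k).
    exists (\sum_k `|Tk k|) => k t x; rewrite (bigD1 k)//= => Tt /andP[x0 xh].
    apply: HTk; last by rewrite x0 (lt_trans xh).
    have := ler_norm (Tk k); have : 0 <= \sum_(i | i != k) `|Tk i| by exact: sumr_ge0.
    lra.
  pose T := Num.max T1 T2.
  have [TT1 TT2] : T1 <= T /\ T2 <= T by rewrite /T !le_max !lexx !orbT.
  pose S := \sum_k rho k * V k h.
  pose beta := S / W - eps - A / 2 * h ^+ 2.
  pose s k := (V k h - eps - beta) / h - A / 2 * h.
  have sE k : beta + s k * h + A / 2 * h ^+ 2 = V k h - eps.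
    by rewrite /s; field; rewrite gt_eqF.
  have ss : 0 <= \sum_k rho k * s k.
    have -> : \sum_k rho k * s k = (\sum_k rho k * V k h + (- eps - beta) * \sum_k rho k) / h
        - A / 2 * h * \sum_k rho k.
      rewrite mulrDl !mulr_sumr !mulr_suml -big_split -sumrB /=; apply: eq_bigr => k _.
      by rewrite /s; ring.
    rewrite -/W -/S /beta le_eqVlt; apply/orP; left; apply/eqP.
    by field; rewrite !gt_eqF.
  have B0 : 0 <= B by exact: le_trans (normr_ge0 _) (ev_bound (ev k0) 0 I0).
  pose Z := `|beta| + A / 2 * h ^+ 2 + \sum_k `|s k| * h.
  have Z0 : 0 <= Z.
    apply: addr_ge0; first apply: addr_ge0 => //.
      by rewrite mulr_ge0 ?sqr_ge0// divr_ge0.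
    by apply: sumr_ge0 => k _; rewrite mulr_ge0// ltW.
  pose N := Z + B + 1; have N0 : 0 < N by rewrite /N; lra.
  have rate : 0 < (2 * h ^+ 2)^-1 by rewrite invr_gt0 mulr_gt0// exprn_gt0.
  have N3 : 0 < 3 * N by rewrite mulr_gt0.
  have [T3 H3] := expR_decay T rate N3 e0.
  have cU k : {within [set q : R * R | q.2 \in `[0, h]], continuous (fun q => U k q.1 q.2)}.
    have sub := evolves_sub (lexx 0) (ltW hr) (ev k); exact: (ev_continuous sub).
  have [T4 H4] := cvg_pinfty_eps (ev_lim (ev k0) I0) e0.
  pose t := Num.max T (Num.max T3 T4).
  have [tT [tT3 tT4]] : T <= t /\ T3 <= t /\ T4 <= t.
    exact: le_max3.
  have hh : 0 < h <= h by rewrite h0 lexx.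
  have main : beta + s k0 * 0 + A / 2 * 0 ^+ 2 -
      3 * N * expR (- (2 * h ^+ 2)^-1 * (t - T)) <= U k0 t 0.
    apply: (@star_comparison _ K rho (fun _ => h) s U T beta A N h) => //.
    - by move=> k t' x Tt'; apply: HT2; exact: le_lt_trans Tt'.
    - move=> k t' Tt'; rewrite sE; have := HT1 k t' (le_trans TT1 Tt').
      by rewrite ltr_norml => /andP[? ?]; lra.
    - move=> k x /andP[x0 xh].
      have xr : 0 <= x <= r0 by rewrite x0 (le_trans xh)// ltW.
      have := ev_bound (ev k) T xr; rewrite ler_norml => /andP[BU _].
      have sx : s k * x <= \sum_k `|s k| * h.
        apply: (@le_trans _ _ (`|s k| * h)).
          apply: (le_trans (ler_norm _)); rewrite normrM (ger0_norm x0).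
          by rewrite ler_wpM2l.
        by rewrite (bigD1 k)//= lerDl sumr_ge0// => i _; rewrite mulr_ge0// ltW.
      have x2 : A / 2 * x ^+ 2 <= A / 2 * h ^+ 2.
        by rewrite ler_wpM2l ?divr_ge0// lerXn2r// nnegrE// ltW.
      have := ler_norm beta; rewrite /N /Z; lra.
    - by rewrite lexx ltW.
  have := H3 t tT3; have := H4 t tT4; rewrite ltr_norml => /andP[_ u1] u2.
  have : beta <= V k0 0 + 2 * eps by move: main; rewrite mulr0 expr0n /= mulr0; lra.
  rewrite /beta => b1.
  have : S / W <= V k0 0 + 3 * eps + A / 2 * h ^+ 2 by lra.
  rewrite ler_pdivrMr// -/S => b2.
  have : eps' = 4 * eps * W by rewrite /eps; field; rewrite gt_eqF.
  have := mulr_gt0 e0 W0; lra.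
have d1 := rderiv_sum (fun k => rderivZ (a := rho k) (dp k)).
have d2 := is_derive_rderiv (is_derive_parabola 0 0 (W * A) (0 : R) 0).
have d3 := rderivD d1 (rderivZ (a := -1) d2).
have -> : \sum_k rho k * p k = \sum_k rho k * p k + -1 * (0 + W * A * (0 - 0)).
  by rewrite subrr mulr0 addr0 mulr0 addr0.
apply: (rderiv_le0 r00 _ d3) => h hr; have /= := key h hr.
have -> : \sum_k rho k * V k 0 = W * V k0 0.
  by rewrite /W mulr_suml; apply: eq_bigr => k _; rewrite V0.
rewrite !add0r !subr0 !mul0r !add0r; lra.
Qed.

End LongTimeLimits.

(** * The limit profile *)

Section LimitProfile.
Variables (R : realType).

Lemma evolves_pair (U : R -> R -> R) (V : R -> R) (y0 y1 A B : R) :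
  {within [set p : R * R | p.2 \in `[y0, y1]], continuous (fun p => U p.1 p.2)} ->
  (exists T : R, forall t x, T < t -> y0 < x < y1 ->
     exists2 m, heat_at U t x m & `|m| <= A) ->
  (forall t x, y0 <= x <= y1 -> `|U t x| <= B) ->
  (forall x, y0 <= x <= y1 -> U t x @[t --> +oo] --> V x) ->
  evolves_to U V y0 y1 A B /\
  evolves_to (fun t x => - U t x) (fun x => - V x) y0 y1 A B.
Proof.
move=> cU [T hU] bU lU; split; split => //.
- exists T => t x Tt xy; have [m hm mA] := hU t x Tt xy; exists m => //.
  by move: mA; rewrite ler_norml => /andP[].
- by move=> p; apply: cvgN; exact: cU.
- exists T => t x Tt xy; have [m hm mA] := hU t x Tt xy.
  exists (- m); first exact: heat_at_opp.
  by move: mA; rewrite ler_norml lerN2 => /andP[].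
- by move=> t x xy; rewrite normrN; exact: bU.
- by move=> x xy; apply: cvgN; exact: lU.
Qed.

(** Brings the end of a center edge at [clen e] to the origin. *)
Lemma evolves_reflect (U : R -> R -> R) (V : R -> R) (y0 y1 c A B : R) :
  evolves_to U V y0 y1 A B ->
  evolves_to (fun t x => U t (c - x)) (fun x => V (c - x)) (c - y1) (c - y0) A B.
Proof.
move=> [cU [T hU] bU lU].
have refl x : c - y1 <= x <= c - y0 -> y0 <= c - x <= y1.
  by move=> /andP[? ?]; apply/andP; split; lra.
split.
- have -> : (fun p : R * R => U p.1 (c - p.2)) =
      (fun p => U p.1 p.2) \o (fun p : R * R => (p.1, c + -1 * p.2)).
    by apply/funext => p /=; rewrite mulN1r.
  apply: within_comp cU; first exact: continuous_shift_snd.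
  by move=> p /=; rewrite !in_itv /= mulN1r; exact: refl.
- exists T => t x Tt /andP[? ?]; have [|m hm mA] := hU t (c - x) Tt.
    by apply/andP; split; lra.
  by exists m => //; exact: heat_at_reflect.
- by move=> t x /refl; exact: bU.
- by move=> x /refl; exact: lU.
Qed.

Variables (Om : star_graph R) (f : R -> R) (a : R).
Variables (u : R -> gfun Om) (vhat : gfun Om).
Hypothesis hf : bistable f a.
Hypothesis hu : entire_solution f u.
Hypothesis hu01 : forall t, between01 (u t).
Hypothesis hlim : limit_profile u vhat.

Lemma dom_segment (e : edge Om) (y0 y1 x : R) : y0 \in edge_dom e ->
  y1 \in edge_dom e -> y0 <= x <= y1 -> x \in edge_dom e.
Proof.
case: e => [e|j] /=; rewrite !in_itv /= ?andbT.
  by move=> /andP[a0 _] /andP[_ b1] /andP[ax xb]; rewrite (le_trans a0 ax) (le_trans xb).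
by move=> a0 _ /andP[ax _]; exact: le_trans ax.
Qed.

Lemma int_segment (e : edge Om) (y0 y1 x : R) : y0 \in edge_dom e ->
  y1 \in edge_dom e -> y0 < x < y1 -> x \in edge_int e.
Proof.
case: e => [e|j] /=; rewrite !in_itv /= ?andbT.
  move=> /andP[a0 _] /andP[_ b1] /andP[ax xb].
  by rewrite (le_lt_trans a0 ax) (lt_le_trans xb).
by move=> a0 _ /andP[ax _]; exact: le_lt_trans ax.
Qed.

Lemma solution_heat (e : edge Om) (t x : R) : x \in edge_int e ->
  heat_at (fun t x => u t e x) t x (f (u t e x)).
Proof.
move=> xe; have [dt dx dx2] := solution_interior t hu xe.
have [r r0 Hr] := edge_int_open xe.
exists (derive1 (u t e)), (derive1n 2 (u t e) x), (derive1n 2 (u t e) x + f (u t e x)), r.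
by split=> //; [move=> y /Hr; exact: dx|ring].
Qed.

Lemma limit_profile_between01 : between01 vhat.
Proof.
move=> e x xe; have cu := hlim xe; rewrite -(cvg_lim (@norm_hausdorff _ _) cu).
have cvu : cvg (u t e x @[t --> +oo]) by apply/cvg_ex; exists (vhat e x).
apply/andP; split; [apply: limr_ge|apply: limr_le] => //; near=> t;
  by have /andP[] := hu01 t xe.
Unshelve. all: by end_near. Qed.

Lemma bistable_bound (L : R) :
  (forall r s, 0 <= r <= 1 -> 0 <= s <= 1 -> `|f s - f r| <= L * `|s - r|) ->
  forall s, 0 <= s <= 1 -> `|f s| <= L.
Proof.
move=> HL s s01; have L0 : 0 <= L.
  have := HL 0 1; rewrite !lexx ler01 subr0 normr1 mulr1 => /(_ isT isT).
  exact: le_trans.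
have := HL 0 s; rewrite lexx ler01 (bi_f0 hf) !subr0 => /(_ isT s01) /le_trans; apply.
by case/andP: s01 => s0 s1; rewrite ger0_norm// ler_piMr.
Qed.

Lemma solution_evolves (L : R) (e : edge Om) (y0 y1 : R) :
  (forall r s, 0 <= r <= 1 -> 0 <= s <= 1 -> `|f s - f r| <= L * `|s - r|) ->
  y0 \in edge_dom e -> y1 \in edge_dom e ->
  evolves_to (fun t x => u t e x) (vhat e) y0 y1 L 1 /\
  evolves_to (fun t x => - u t e x) (fun x => - vhat e x) y0 y1 L 1.
Proof.
move=> HL ye0 ye1; apply: evolves_pair.
- apply: continuous_subspaceW (sol_continuous hu (e := e)) => p /=.
  by rewrite in_itv /=; exact: dom_segment.
- exists 0 => t x _ xy; have xe := int_segment ye0 ye1 xy.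
  exists (f (u t e x)); first exact: solution_heat.
  by apply: bistable_bound HL _ _; apply: hu01; exact: edge_int_dom.
- move=> t x xy; have := hu01 t (dom_segment ye0 ye1 xy).
  by rewrite ler_norml => /andP[? ?]; apply/andP; split; lra.
- by move=> x xy; apply: hlim; exact: dom_segment xy.
Qed.

Lemma limit_profile_chord (L : R) (e : edge Om) (y0 y1 x : R) :
  (forall r s, 0 <= r <= 1 -> 0 <= s <= 1 -> `|f s - f r| <= L * `|s - r|) ->
  0 <= L -> y0 \in edge_dom e -> y1 \in edge_dom e -> y0 < y1 -> y0 <= x <= y1 ->
  `|vhat e x - chord y0 y1 (vhat e y0) (vhat e y1) x| <= L / 2 * ((x - y0) * (y1 - x)).
Proof.
move=> HL L0 ye0 ye1 y01 xy; have [e1 e2] := solution_evolves HL ye0 ye1.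
have := evolves_chord y01 L0 e1 xy; have := evolves_chord y01 L0 e2 xy.
have -> : chord y0 y1 (- vhat e y0) (- vhat e y1) x =
  - chord y0 y1 (vhat e y0) (vhat e y1) x by rewrite /chord; ring.
by rewrite ler_norml => ? ?; apply/andP; split; lra.
Qed.

(** On an interval of fixed length starting or ending at [x], the chord estimate
    is linear in the distance to [x]. *)
Lemma limit_profile_lipschitz (e : edge Om) : exists2 K : R, 0 <= K &
  forall x y, x \in edge_dom e -> y \in edge_dom e ->
    `|vhat e x - vhat e y| <= K * `|x - y|.
Proof.
have [L L0 HL] := bistable_lipschitz hf.
pose rho := edge_unit e / 2.
have rho0 : 0 < rho by rewrite divr_gt0// edge_unit_gt0.
pose K := rho^-1 + L / 2 * rho.
have Lr0 : 0 <= L / 2 * rho by apply: mulr_ge0 (ltW rho0); apply: divr_ge0 (ltW L0) _.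
have K0 : 0 <= K by rewrite addr_ge0// invr_ge0 ltW.
have Krho : rho^-1 <= K by rewrite lerDl.
exists K => //.
suff lt x y : x \in edge_dom e -> y \in edge_dom e -> x < y ->
    `|vhat e x - vhat e y| <= K * `|x - y|.
  move=> x y xe ye; case: (ltgtP x y) => [xy|yx|->]; first exact: lt.
    by rewrite distrC [`|x - y|]distrC; exact: lt.
  by rewrite !subrr !normr0 mulr0.
move=> xe ye xy.
have v01 z : z \in edge_dom e -> 0 <= vhat e z <= 1 by exact: limit_profile_between01.
have diff1 z z' : z \in edge_dom e -> z' \in edge_dom e -> `|vhat e z - vhat e z'| <= 1.
  by move=> /v01 ? /v01 ?; rewrite ler_norml; apply/andP; split; lra.
have yx0 : 0 < y - x by rewrite subr_gt0.
rewrite [`|x - y|]distrC (gtr0_norm yx0).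
case: (leP rho (y - x)) => ryx.
  apply: (le_trans (diff1 _ _ xe ye)); apply: (@le_trans _ _ (rho^-1 * (y - x))).
    by rewrite ler_pdivlMl// mulr1.
  by rewrite ler_wpM2r// ltW.
have chord_le (s d w : R) : `|d| <= 1 -> `|s - d / rho * (y - x)| <= w ->
    w <= L / 2 * rho * (y - x) -> `|s| <= K * (y - x).
  move=> d1 sd wle; rewrite (_ : s = s - d / rho * (y - x) + d / rho * (y - x)); last by ring.
  apply: (le_trans (ler_normD _ _)); rewrite /K mulrDl addrC lerD//; last exact: le_trans wle.
  rewrite !normrM (gtr0_norm yx0) ler_wpM2r ?(ltW yx0)//.
  by rewrite normfV (gtr0_norm rho0) ler_piMl// invr_ge0 ltW.
have L20 : 0 <= L / 2 by rewrite divr_ge0// ltW.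
have [xr|yr] : x + rho \in edge_dom e \/ y - rho \in edge_dom e.
  move: xe ye; rewrite /rho; case: (e) => [e'|j] /=; rewrite !in_itv /= ?andbT.
    move=> /andP[x0 xl] /andP[y0 yl]; case: (leP x (clen e' / 2)) => xm.
      by left; have := clen_gt0 e'; move=> ?; apply/andP; split; lra.
    by right; apply/andP; split; lra.
  by move=> x0 _; left; lra.
- have xx : x < x + rho by rewrite ltrDl.
  have yxr : x <= y <= x + rho by rewrite ltW//=; lra.
  have := limit_profile_chord HL (ltW L0) xe xr xx yxr; rewrite distrC => ch.
  apply: (chord_le _ (vhat e x - vhat e (x + rho))
    (L / 2 * ((y - x) * (x + rho - y))) (diff1 _ _ xe xr)).
    apply: le_trans ch; rewrite le_eqVlt; apply/orP; left; apply/eqP; congr (`| _ |).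
    rewrite /chord (_ : x + rho - x = rho); last by ring.
    by field; rewrite gt_eqF.
  rewrite -[X in _ <= X]mulrA; apply: ler_wpM2l => //; rewrite mulrC.
  by apply: ler_wpM2r; [exact: ltW|lra].
- have yy : y - rho < y by rewrite gtrBl.
  have xyr : y - rho <= x <= y by rewrite (ltW xy) andbT; lra.
  have := limit_profile_chord HL (ltW L0) yr ye yy xyr => ch.
  apply: (chord_le _ (vhat e (y - rho) - vhat e y)
    (L / 2 * ((x - (y - rho)) * (y - x))) (diff1 _ _ yr ye)).
    apply: le_trans ch; rewrite le_eqVlt; apply/orP; left; apply/eqP; congr (`| _ |).
    rewrite /chord (_ : y - (y - rho) = rho); last by ring.
    by field; rewrite gt_eqF.
  rewrite -[X in _ <= X]mulrA; apply: ler_wpM2l => //.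
  by apply: ler_wpM2r; [exact: ltW|lra].
Qed.

Definition clamp (e : edge Om) (x : R) : R :=
  match e with inl e => Num.max 0 (Num.min x (clen e)) | inr _ => Num.max 0 x end.

Lemma clamp_dom e x : clamp e x \in edge_dom e.
Proof.
case: e => [e|j] /=; rewrite in_itv /= le_max lexx //=.
by rewrite ge_max ge_min lexx orbT andbT ltW// clen_gt0.
Qed.

Lemma clamp_id e x : x \in edge_dom e -> clamp e x = x.
Proof.
case: e => [e|j] /=; rewrite in_itv /= ?andbT.
  by move=> /andP[x0 xl]; rewrite (min_idPl xl) (max_idPr x0).
by move=> x0; rewrite (max_idPr x0).
Qed.

Lemma clamp_continuous e : continuous (clamp e).
Proof.
case: e => [e|j] x; rewrite /clamp; last first.
  by apply: continuous_max; [exact: cvg_cst|exact: cvg_id].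
apply: (@continuous_max _ _ (fun _ => 0) (fun y => Num.min y (clen e))).
  exact: cvg_cst.
by apply: continuous_min; [exact: cvg_id|exact: cvg_cst].
Qed.

Lemma limit_profile_clamp_continuous e : continuous (fun x => vhat e (clamp e x)).
Proof.
have [K K0 HK] := limit_profile_lipschitz e.
have cv : {within [set` edge_dom e], continuous (vhat e)}.
  by apply: lipschitz_within K0 _ => x y; exact: HK.
have := within_comp (D' := setT) (@clamp_continuous e) (fun x _ => clamp_dom e x) cv.
move=> /subspace_continuousP H x A nA.
have H1 : nbhs x [set y | True -> A (vhat e (clamp e y))] := H x I A nA.
suff : nbhs x [set y | A (vhat e (clamp e y))] by [].
by apply: filterS H1 => y; exact.
Qed.

(** Adding a second antiderivative of [f (vhat e x)] to [u] makes the heat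
    operator tend to 0 uniformly, so the limit coincides with its chords. *)
Lemma limit_profile_plus_antiderivative (e : edge Om) (F F1 : R -> R) (y0 y1 x : R) :
  (forall x : R, -1 < x -> is_derive x 1 F (F1 x) /\
     is_derive x 1 F1 (f (vhat e (clamp e x)))) ->
  y0 \in edge_dom e -> y1 \in edge_dom e -> y0 < y1 -> y0 <= x <= y1 ->
  vhat e x + F x = chord y0 y1 (vhat e y0 + F y0) (vhat e y1 + F y1) x.
Proof.
move=> dF ye0 ye1 y01 xy.
have [L L0 HL] := bistable_lipschitz hf.
have [K K0 HK] := limit_profile_lipschitz e.
have dom z : y0 <= z <= y1 -> z \in edge_dom e by exact: dom_segment.
have dom1 z : z \in edge_dom e -> -1 < z.
  by case: (e) => [e'|j] /=; rewrite in_itv /= => /andP[z0 _]; lra.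
have cF z : -1 < z -> {for z, continuous F}.
  by move=> /dF[[d _] _]; exact/differentiable_continuous/derivable1_diffP.
have cFw : {within `[y0, y1], continuous F}.
  apply: continuous_in_subspaceT => z; rewrite inE /= in_itv /= => /dom/dom1; exact: cF.
have [BF HBF] := segment_bounded (ltW y01) cFw.
have lipv z z' : y0 <= z <= y1 -> y0 <= z' <= y1 -> `|vhat e z - vhat e z'| <= K * `|z - z'|.
  by move=> /dom ze /dom z'e; exact: HK.
have [ev1 ev2] := solution_evolves HL ye0 ye1.
have near_zero (eta : R) : 0 < eta ->
    evolves_to (fun t x => u t e x + F x) (fun x => vhat e x + F x) y0 y1 eta (1 + BF) /\
    evolves_to (fun t x => - (u t e x + F x)) (fun x => - (vhat e x + F x)) y0 y1 eta (1 + BF).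
  move=> eta0; have eL : 0 < eta / L by rewrite divr_gt0.
  have [T1 HT1] := evolves_uniform y01 (ltW L0) K0 ev1 lipv eL.
  have lipv' z z' : y0 <= z <= y1 -> y0 <= z' <= y1 ->
      `|- vhat e z - - vhat e z'| <= K * `|z - z'|.
    by move=> zy zy'; rewrite -opprD normrN; exact: lipv.
  have [T2 HT2] := evolves_uniform y01 (ltW L0) K0 ev2 lipv' eL.
  apply: evolves_pair.
  - move=> p; apply: cvgD; first exact: (ev_continuous ev1).
    exact: (within_snd cFw).
  - exists (Num.max T1 T2) => t z; rewrite gt_max => /andP[Tt1 Tt2] zy.
    have ze := int_segment ye0 ye1 zy; have zd := edge_int_dom ze.
    have zy' : y0 <= z <= y1 by case/andP: zy => ? ?; rewrite !ltW.
    exists (f (u t e z) - f (vhat e z)).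
      have [r r0 Hr] := edge_int_open ze.
      apply: (heat_at_addr (F1 := F1) r0).
      + by move=> y /Hr/edge_int_dom/dom1/dF[].
      + by have [_] := dF z (dom1 _ zd); rewrite clamp_id.
      + exact: solution_heat.
    apply: (le_trans (HL _ _ (limit_profile_between01 zd) (hu01 t zd))).
    rewrite mulrC -ler_pdivlMr// ler_norml.
    have := HT1 t z (ltW Tt1) zy'; have := HT2 t z (ltW Tt2) zy'.
    by move=> ? ?; apply/andP; split; lra.
  - move=> t z zy; apply: (le_trans (ler_normD _ _)); apply: lerD; last exact: HBF.
    exact: (ev_bound ev1).
  - by move=> z zy; apply: cvgD; [exact: (ev_lim ev1)|exact: cvg_cst].
have xy0 : 0 <= (x - y0) * (y1 - x).
  by case/andP: xy => ? ?; rewrite mulr_ge0// subr_ge0.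
pose Y := (x - y0) * (y1 - x) / 2 + 1.
have Y0 : 0 < Y by rewrite /Y; lra.
have small (eps : R) : 0 < eps -> eps / Y / 2 * ((x - y0) * (y1 - x)) <= eps.
  move=> e0; have -> : eps / Y / 2 * ((x - y0) * (y1 - x)) =
    eps * (((x - y0) * (y1 - x) / 2) / Y) by field; rewrite gt_eqF.
  by rewrite ler_piMr ?(ltW e0)// ler_pdivrMr// mul1r /Y; lra.
apply/eqP; rewrite eq_le; apply/andP; split; apply/ler_addgt0Pr => eps e0.
  have eY : 0 < eps / Y by rewrite divr_gt0.
  have [_ evm] := near_zero _ eY.
  have := evolves_chord y01 (ltW eY) evm xy; have := small eps e0.
  have -> : chord y0 y1 (- (vhat e y0 + F y0)) (- (vhat e y1 + F y1)) x =
    - chord y0 y1 (vhat e y0 + F y0) (vhat e y1 + F y1) x by rewrite /chord; ring.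
  by lra.
have eY : 0 < eps / Y by rewrite divr_gt0.
have [evp _] := near_zero _ eY.
by have := evolves_chord y01 (ltW eY) evp xy; have := small eps e0; lra.
Qed.

(** The profile plus the antiderivative is affine, so the profile is as regular
    as the antiderivative, up to the ends of the edge. *)
Lemma limit_profile_regular (e : edge Om) : exists w w1 : R -> R,
  [/\ forall x, x \in edge_dom e -> vhat e x = w x,
      forall x, x \in edge_dom e -> is_derive x 1 w (w1 x) &
      forall x, x \in edge_dom e -> is_derive x 1 w1 (- f (vhat e x))].
Proof.
have cfv : continuous (fun x => f (vhat e (clamp e x))).
  move=> x; apply: (@continuous_comp _ _ _ (fun x => vhat e (clamp e x)) f).
    exact: limit_profile_clamp_continuous.
  exact: (bistable_continuous hf).
have [F [F1 dF]] := second_antiderivative cfv.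
have dom1 z : z \in edge_dom e -> -1 < z.
  by case: (e) => [e'|j] /=; rewrite in_itv /= => /andP[z0 _]; lra.
pose r := edge_unit e; have r0 : 0 < r by exact: edge_unit_gt0.
have e0 : 0 \in edge_dom e.
  by case: (e) => [e'|j] /=; rewrite in_itv /= lexx //= ltW// clen_gt0.
have er : r \in edge_dom e.
  rewrite /r; case: (e) => [e'|j] /=; rewrite in_itv /= ?lexx ?ler01 ?andbT//.
  by rewrite ltW// clen_gt0.
pose G x := vhat e x + F x; pose p := (G r - G 0) / r.
have GE x : x \in edge_dom e -> G x = G 0 + p * x.
  move=> xe; have x0 : 0 <= x.
    by move: xe; case: (e) => [e'|j] /=; rewrite in_itv /= => /andP[].
  case: (leP x r) => xr.
    have xr' : 0 <= x <= r by rewrite x0.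
    have := limit_profile_plus_antiderivative dF e0 er r0 xr'.
    by rewrite -/(G x) -/(G 0) -/(G r) => ->; rewrite /chord !subr0.
  have x0' : 0 < x by exact: lt_trans xr.
  have rx : 0 <= r <= x by rewrite !ltW.
  have := limit_profile_plus_antiderivative dF e0 xe x0' rx.
  rewrite -/(G x) -/(G 0) -/(G r) /p => ->; rewrite /chord !subr0.
  by field; rewrite !gt_eqF.
exists (fun x => G 0 + p * (x - 0) - F x), (fun x => p - F1 x); split.
- by move=> x xe; have := GE x xe; rewrite subr0 => <-; rewrite /G addrK.
- by move=> x /dom1/dF[dFx _]; exact: is_derive_subf (is_derive_affine _ _ _ _) dFx.
- move=> x xe; have [_] := dF x (dom1 x xe); rewrite clamp_id// => dF1x.
  rewrite -[- f _]add0r; exact: is_derive_subf (is_derive_cst p x 1) dF1x.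
Qed.

Lemma limit_profile_vertex_compatible : vertex_compatible vhat.
Proof.
have /choice[val Hval] : forall t, exists val : vert Om -> R,
    (forall e : edge Om, u t e 0 = val (src e)) /\
    (forall e : cedge Om, u t (inl e) (clen e) = val (ctgt e)).
  by move=> t; exact: (sol_vertex hu t).
exists (fun V => lim (val t V @[t --> +oo])); split=> e.
  have e0 : 0 \in edge_dom e.
    by case: (e) => [e'|j] /=; rewrite in_itv /= lexx //= ltW// clen_gt0.
  rewrite -(cvg_lim (@norm_hausdorff _ _) (hlim e0)).
  rewrite (_ : (fun t => u t e 0) = (fun t => val t (src e)))//.
  by apply/funext => t; have [-> _] := Hval t.
have el : clen e \in edge_dom (inl e : edge Om).
  by rewrite /= in_itv /= lexx andbT ltW// clen_gt0.
rewrite -(cvg_lim (@norm_hausdorff _ _) (hlim el)).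
rewrite (_ : (fun t => u t (inl e) (clen e)) = (fun t => val t (ctgt e)))//.
by apply/funext => t; have [_ ->] := Hval t.
Qed.

Lemma limit_profile_C1 (e : edge Om) : C1_on (edge_dom e) (vhat e).
Proof.
have [w [w1 [vw dw dw1]]] := limit_profile_regular e; exists w1; split.
  apply: continuous_in_subspaceT => x; rewrite inE /= => xe.
  by apply/differentiable_continuous/derivable1_diffP; have [] := dw1 x xe.
move=> x xe; apply/cvgrPdist_lt => eps e0.
have [d d0 H] := is_derive_eps (dw x xe) e0.
exists d => // y /= xy [ye yx]; rewrite (vw x xe) (vw y ye) distrC.
have yx0 : y - x != 0 by rewrite subr_eq0.
have yxd : `|y - x| < d by rewrite distrC.
by have := H (y - x) yx0 yxd; rewrite subrKC.
Qed.

Lemma end_evolves (L r0 : R) (k : eend Om) :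
  (forall r s, 0 <= r <= 1 -> 0 <= s <= 1 -> `|f s - f r| <= L * `|s - r|) ->
  0 < r0 -> r0 <= edge_unit (end_edge k) ->
  evolves_to (fun t x => end_fun (u t) k x) (end_fun vhat k) 0 r0 L 1 /\
  evolves_to (fun t x => - end_fun (u t) k x) (fun x => - end_fun vhat k x) 0 r0 L 1.
Proof.
move=> HL r00; case: k => [e|e] /= ru.
  have e0 : 0 \in edge_dom e.
    by case: (e) => [e'|j] /=; rewrite in_itv /= lexx //= ltW// clen_gt0.
  have er : r0 \in edge_dom e.
    by move: ru; case: (e) => [e'|j] /= ru; rewrite in_itv /= (ltW r00).
  exact: solution_evolves HL e0 er.
have el : clen e \in edge_dom (inl e : edge Om).
  by rewrite /= in_itv /= lexx andbT ltW// clen_gt0.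
have elr : clen e - r0 \in edge_dom (inl e : edge Om).
  by rewrite /= in_itv /=; apply/andP; split; lra.
have [e1 e2] := solution_evolves HL elr el.
have := evolves_reflect (clen e) e1; have := evolves_reflect (clen e) e2.
by rewrite subrr (_ : clen e - (clen e - r0) = r0); [split|ring].
Qed.

(** The equality is the inequality for [u] together with the one for [- u]. *)
Lemma limit_profile_kirchhoff (V : vert Om) : flux vhat V = 0.
Proof.
have [L L0 HL] := bistable_lipschitz hf.
have [p dp] := C1_ends_rderiv limit_profile_C1; rewrite (flux_ends V dp).
(* a radius smaller than every edge, so that the ends at [V] form a star *)
pose r0 := (1 + \sum_(e : edge Om) (edge_unit e)^-1)^-1.
have ui (e : edge Om) : 0 <= (edge_unit e)^-1 by rewrite invr_ge0 ltW// edge_unit_gt0.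
have S0 : 0 < 1 + \sum_(e : edge Om) (edge_unit e)^-1.
  by rewrite ltr_wpDr// sumr_ge0.
have r00 : 0 < r0 by rewrite invr_gt0.
have r0u (e : edge Om) : r0 <= edge_unit e.
  rewrite /r0 -[X in _ <= X]invrK lef_pV2 ?posrE ?invr_gt0 ?edge_unit_gt0//.
  by rewrite (bigD1 e)//= addrCA lerDl addr_ge0// sumr_ge0.
pose K : finType := {k : eend Om | end_vert k == V}.
pose rho (k : K) := thick (end_edge (val k)).
have rho0 k : 0 < rho k by exact: thick_gt0.
have sumE (q : eend Om -> R) : \sum_(k : eend Om | end_vert k == V) thick (end_edge k) * q k =
    \sum_(k : K) rho k * q (val k).
  exact: (big_sub (fun k : eend Om => end_vert k == V) (fun k => thick (end_edge k) * q k)).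
have vv (v : gfun Om) (k l : K) : vertex_compatible v -> end_fun v (val k) 0 = end_fun v (val l) 0.
  by move=> vc; apply: end_fun_vertex vc _; rewrite (eqP (valP k)) (eqP (valP l)).
have ku t : exists q : K -> R, (forall k, rderiv (end_fun (u t) (val k)) (q k)) /\
    \sum_k rho k * q k = 0.
  have [q dq] := C1_ends_rderiv (fun e => sol_C1 hu e t).
  exists (fun k => q (val k)); split; first by move=> k; exact: dq.
  by rewrite -sumE -(flux_ends V dq) (sol_kirchhoff hu).
rewrite sumE; apply/eqP; rewrite eq_le; apply/andP; split.
  apply: (evolves_kirchhoff r00 (ltW L0) rho0 (U := fun k t x => end_fun (u t) (val k) x)
     (V := fun k x => end_fun vhat (val k) x) (B := 1)).
  - by move=> k; have [] := end_evolves HL r00 (r0u (end_edge (val k))).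
  - by move=> k l t; apply: vv; exact: (sol_vertex hu t).
  - by move=> t; have [q [dq q0]] := ku t; exists q; split=> //; rewrite q0.
  - by move=> k; exact: dp.
rewrite -oppr_le0 -sumrN; under eq_bigr do rewrite -mulrN.
apply: (evolves_kirchhoff r00 (ltW L0) rho0 (U := fun k t x => - end_fun (u t) (val k) x)
   (V := fun k x => - end_fun vhat (val k) x) (B := 1)).
- by move=> k; have [] := end_evolves HL r00 (r0u (end_edge (val k))).
- by move=> k l t; congr (- _); apply: vv; exact: (sol_vertex hu t).
- move=> t; have [q [dq q0]] := ku t; exists (fun k => - q k); split.
    by move=> k; apply: (rderiv_eq (rderivZ (a := -1) (dq k))) => [|x]; rewrite mulN1r.
  by under eq_bigr do rewrite mulrN; rewrite sumrN q0 oppr0.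
- by move=> k; apply: (rderiv_eq (rderivZ (a := -1) (dp (val k)))) => [|x]; rewrite mulN1r.
Qed.

Lemma limit_profile_stationary : stationary_solution f vhat.
Proof.
split.
- move=> e; have [K K0 HK] := limit_profile_lipschitz e.
  apply: (@within_snd _ [set` edge_dom e]).
  by apply: lipschitz_within K0 _ => x y; exact: HK.
- by move=> _; exact: limit_profile_vertex_compatible.
- move=> e t x xe; have [w [w1 [vw dw dw1]]] := limit_profile_regular e.
  have dv y : y \in edge_int e -> is_derive y 1 (vhat e) (w1 y).
    move=> ye; have [r r0 Hr] := edge_int_open ye.
    apply: (is_derive_near r0 _ (dw y (edge_int_dom ye))) => z /Hr/edge_int_dom.
    exact: vw.
  have d2 : is_derive x 1 (derive1 (vhat e)) (- f (vhat e x)).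
    have [r r0 Hr] := edge_int_open xe.
    apply: (is_derive_near r0 _ (dw1 x (edge_int_dom xe))) => z /Hr ze.
    exact: is_derive_derive1 (dv z ze).
  split; first exact: derivable_cst.
  split; first by split; [have [] := dv x xe|have [] := d2].
  rewrite /derive1n /= (is_derive_derive1 d2) addNr.
  exact: is_derive_derive1.
- by move=> e _; exact: limit_profile_C1.
- by move=> _; exact: limit_profile_kirchhoff.
Qed.

End LimitProfile.

Theorem theorem2p2 (R : realType) (Om : star_graph R) (f : R -> R) (a : R)
    (phi : R -> R) (c : R) (i : 'I_(npaths Om))
    (uhat : R -> gfun Om) (vhat : gfun Om)
    (hf : bistable f a) (hphi : travelling_wave f a phi c)
    (huhat : front_like f phi c i uhat) (hvhat : limit_profile uhat vhat) :
  (forall v : gfun Om, supersolution f v -> between01 v ->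
     tends_to_1_on i v -> gforall (fun e x => vhat e x <= v e x)) /\
  ((stationary_solution f vhat /\ between01 vhat /\ tends_to_1_on i vhat) /\
   (forall v : gfun Om, stationary_solution f v -> between01 v ->
      tends_to_1_on i v -> gforall (fun e x => vhat e x <= v e x))).
Proof.
have min_super (v : gfun Om) : supersolution f v -> between01 v ->
    tends_to_1_on i v -> gforall (fun e x => vhat e x <= v e x).
  move=> vs v01 v1; apply: (limit_profile_le hvhat).
  exact: (front_like_le_supersolution hf hphi huhat vs v01 v1).
have [us u01 _] := huhat.
have u01' t : between01 (uhat t).
  by move=> e x xe; have /andP[? ?] := u01 t e x xe; rewrite !ltW.
have v01 : between01 vhat by exact: limit_profile_between01 u01' hvhat.
split; first exact: min_super.
split; last by move=> v /stationary_supersolution; exact: min_super.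
split; first exact: (limit_profile_stationary hf us u01' hvhat).
by split=> //; exact: (limit_profile_tends_to_1 hf hphi huhat hvhat v01).
Qed.
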